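(* Let $a,b_1,b_2,c,t_1,t_2\in\mathbb{C}$ with $\Re(c)\ne0,-1,-2,\dots$ (and, in (5) and (6), also $\Re(c-r)\neq0,-1,-2,\dots$), let $k_1,k_2,r\in\mathbb{N}$, and let $x,y$ be such that the two variables of the functions $\mathcal{F}_1^{(1)}$ occurring have modulus less than $1$. Then: (1) $$\left(\frac{\partial}{\partial x}\right)^r\left[x^{b_1+r-1}\mathcal{F}_1^{(1)}(a,b_1,b_2;c;t_1,t_2,k_1,k_2,x,y)\right]=x^{b_1-1}(b_1)_r\,\mathcal{F}_1^{(1)}(a,b_1+r,b_2;c;t_1,t_2,k_1,k_2,x,y);$$ (2) $$\left(\frac{\partial}{\partial y}\right)^r\left[y^{b_2+r-1}\mathcal{F}_1^{(1)}(a,b_1,b_2;c;t_1,t_2,k_1,k_2,x,y)\right]=y^{b_2-1}(b_2)_r\,\mathcal{F}_1^{(1)}(a,b_1,b_2+r;c;t_1,t_2,k_1,k_2,x,y);$$ (3) $$\left(\frac{\partial}{\partial x}\right)^r\left[x^{a+r-1}\mathcal{F}_1^{(1)}(a,b_1,b_2;c;t_1,t_2,k_1,k_2,x,xy)\right]=x^{a-1}(a)_r\,\mathcal{F}_1^{(1)}(a+r,b_1,b_2;c;t_1,t_2,k_1,k_2,x,xy);$$ (4) $$\left(\frac{\partial}{\partial y}\right)^r\left[y^{a+r-1}\mathcal{F}_1^{(1)}(a,b_1,b_2;c;t_1,t_2,k_1,k_2,xy,y)\right]=y^{a-1}(a)_r\,\mathcal{F}_1^{(1)}(a+r,b_1,b_2;c;t_1,t_2,k_1,k_2,xy,y);$$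 (5) $$\left(\frac{\partial}{\partial x}\right)^r\left[x^{c-1}\mathcal{F}_1^{(1)}(a,b_1,b_2;c;t_1,t_2,k_1,k_2,x,xy)\right]=(-1)^r(1-c)_r\,x^{c-r-1}\mathcal{F}_1^{(1)}(a,b_1,b_2;c-r;t_1,t_2,k_1,k_2,x,xy);$$ (6) $$\left(\frac{\partial}{\partial y}\right)^r\left[y^{c-1}\mathcal{F}_1^{(1)}(a,b_1,b_2;c;t_1,t_2,k_1,k_2,xy,y)\right]=(-1)^r(1-c)_r\,y^{c-r-1}\mathcal{F}_1^{(1)}(a,b_1,b_2;c-r;t_1,t_2,k_1,k_2,xy,y).$$
   Context: $\mathbb{N}$ is the set of natural numbers. The Pochhammer symbol is $(u)_0=1$, $(u)_k=u(u+1)\cdots(u+k-1)$ for $k\ge1$. The first discrete Appell function is $$\mathcal{F}_1^{(1)}(a,b_1,b_2;c;t_1,t_2,k_1,k_2,x,y)=\sum_{m,n\ge 0}\frac{(a)_{m+n}(b_1)_m(b_2)_n(-1)^{mk_1}(-1)^{nk_2}(-t_1)_{mk_1}(-t_2)_{nk_2}}{(c)_{m+n}\,m!\,n!}x^my^n ,$$ where the denominator parameter $c$ is required to satisfy $\Re(c)\neq 0,-1,-2,\dots$. *)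

(* Defs.v *)
From Stdlib Require Import Reals List Factorial ClassicalEpsilon.
From Coquelicot Require Import Coquelicot.

Open Scope R_scope.
Open Scope C_scope.

Fixpoint poch (u : C) (k : nat) : C :=
  match k with
  | O => 1
  | S k' => poch u k' * (u + INR k')
  end.

(* Unordered (equivalently, absolute) summation over nat * nat: the sums over
   finite sets of indices converge to [l] as the sets grow.  The squares
   [0, N] x [0, N] are cofinal among the finite subsets of nat * nat. *)
Definition is_sum2 (f : nat -> nat -> C) (l : C) : Prop :=
  forall eps : posreal, exists N : nat,
    forall J : list (nat * nat),
      NoDup J ->
      (forall m n : nat, (m <= N)%nat -> (n <= N)%nat -> In (m, n) J) ->
      Cmod (fold_right Cplus 0 (map (fun p => f (fst p) (snd p)) J) - l) < eps.

(* The value of the double series, with the convention 0 when it diverges. *)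
Definition Sum2 (f : nat -> nat -> C) : C :=
  match excluded_middle_informative (exists l : C, is_sum2 f l) with
  | left H => proj1_sig (constructive_indefinite_description _ H)
  | right _ => 0
  end.

Definition discreteF1_term (a b1 b2 c t1 t2 : C) (k1 k2 : nat) (x y : C)
    (m n : nat) : C :=
  poch a (m + n) * poch b1 m * poch b2 n
    * (-(1)) ^ (m * k1) * (-(1)) ^ (n * k2)
    * poch (- t1) (m * k1) * poch (- t2) (n * k2)
    / (poch c (m + n) * INR (fact m) * INR (fact n))
    * x ^ m * y ^ n.

Definition discreteF1 (a b1 b2 c t1 t2 : C) (k1 k2 : nat) (x y : C) : C :=
  Sum2 (discreteF1_term a b1 b2 c t1 t2 k1 k2 x y).

Definition Cexp (z : C) : C :=
  (exp (Re z) * cos (Im z), exp (Re z) * sin (Im z))%R.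

(* [L] is a continuous (hence holomorphic) branch of the logarithm near [x].
   Such an [L] exists exactly when x <> 0; off the closed negative real axis
   the principal branch is one of them. *)
Definition is_log_branch (L : C -> C) (x : C) : Prop :=
  locally x (fun z : C => continuous L z /\ Cexp (L z) = z).

(* The power z^s for the branch [L] of the logarithm. *)
Definition cpow (L : C -> C) (s z : C) : C := Cexp (s * L z).

(* [f] has an n-th complex derivative at [z], equal to [l]; the derivatives of
   lower order are required to exist in a neighbourhood of [z]. *)
Fixpoint is_C_derive_n (f : C -> C) (n : nat) (z l : C) : Prop :=
  match n with
  | O => f z = l
  | S n' => exists g : C -> C,
      locally z (fun w : C => is_C_derive_n f n' w (g w)) /\ is_derive g z l
  end.

(* Main.v *)
(* Up to the branch of the power, each function to be differentiated has the form
   z^s * sum B(m,n) z^(w(m,n)) with w(m,n) = m or w(m,n) = m + n.  Where the double series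
   converges absolutely, r-fold termwise differentiation multiplies the (m,n) term by the
   falling factorial of s + w(m,n) and replaces z^s by z^(s-r); the identities then reduce
   to (u)_m (u+m)_r = (u)_r (u+r)_m.  Since (-t)_{mk} grows like (mk)! when k > 0 and t is
   not a natural number, the series may also diverge for every z <> 0; its value is then 0
   by convention, and one checks that the right-hand side vanishes as well: the parameter
   shift cannot turn a non-terminating Pochhammer symbol into a terminating one, and in
   the opposite case the prefactor (u)_r is 0.  The formulas in y follow from those in x
   by exchanging the two variables. *)
Require Import Defs.
From Stdlib Require Import Reals Lra Lia List Permutation Factorial Classical
  ClassicalEpsilon FunctionalExtensionality.
From Coquelicot Require Import Coquelicot.

Open Scope R_scope.
Open Scope C_scope.

(** * Unordered double sums *)

(** Differentiability at a point requires control of a whole neighbourhood, so the case split is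
    made on the parameters and not on convergence at that point. Once the factor coupling the two
    indices is separated, each index carries a weight that either grows subexponentially or has
    quotients tending to infinity in modulus, with nothing in between. When [a] does not terminate,
    a weight of the second kind attached to a nonzero variable makes the terms along a single index
    unbounded, at every nonzero point alike. In every other situation the terms are bounded by
    [M * (p ^ m * q ^ n)] with [p, q < 1]; a second variable that is identically 0 leaves only
    [n = 0], and so belongs here even when its weight is wild. Termwise differentiation then rests
    on a quadratic remainder estimate for each monomial, whose constants have a finite sum by the
    same geometric domination. *)

Definition csum (f : nat -> nat -> C) (J : list (nat * nat)) : C :=
  fold_right Cplus 0 (map (fun p => f (fst p) (snd p)) J).

Definition rsum (g : nat -> nat -> R) (J : list (nat * nat)) : R :=
  fold_right Rplus 0%R (map (fun p => g (fst p) (snd p)) J).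

Definition square (N : nat) : list (nat * nat) :=
  list_prod (seq 0 (S N)) (seq 0 (S N)).

Lemma in_square (N m n : nat) : In (m, n) (square N) <-> (m <= N /\ n <= N)%nat.
Proof.
  unfold square; rewrite in_prod_iff, !in_seq; lia.
Qed.

Lemma NoDup_list_prod {A B : Type} (l : list A) (l' : list B) :
  NoDup l -> NoDup l' -> NoDup (list_prod l l').
Proof.
  intros Hl Hl'; induction Hl as [|a l Ha Hl IH]; simpl; [constructor|].
  apply NoDup_app; auto.
  - apply FinFun.Injective_map_NoDup; auto. intros u v E; now injection E.
  - intros [u v] H1 H2. apply in_map_iff in H1. destruct H1 as [w [E _]].
    injection E as <- <-. apply in_prod_iff in H2. tauto.
Qed.

Lemma NoDup_square (N : nat) : NoDup (square N).
Proof. apply NoDup_list_prod; apply seq_NoDup. Qed.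

Lemma NoDup_incl_Permutation {A : Type} (J0 J : list A) :
  NoDup J0 -> incl J0 J -> exists J', Permutation J (J0 ++ J').
Proof.
  revert J; induction J0 as [|a J0 IH]; intros J Hnd Hin.
  - exists J; apply Permutation_refl.
  - inversion Hnd as [|? ? Ha Hnd0]; subst.
    destruct (in_split a J) as [l1 [l2 ->]]; [apply Hin; now left|].
    destruct (IH (l1 ++ l2) Hnd0) as [J' HJ'].
    + intros u Hu. assert (Hu' : In u (l1 ++ a :: l2)) by (apply Hin; now right).
      apply in_app_iff in Hu'; apply in_app_iff; destruct Hu' as [|[<-|]]; tauto.
    + exists J'. simpl. eapply Permutation_trans.
      * apply Permutation_sym, Permutation_middle.
      * now constructor.
Qed.

Lemma csum_perm f J J' : Permutation J J' -> csum f J = csum f J'.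
Proof.
  induction 1; unfold csum in *; simpl; try congruence. ring.
Qed.

Lemma rsum_perm f J J' : Permutation J J' -> rsum f J = rsum f J'.
Proof.
  induction 1; unfold rsum in *; simpl; try congruence. ring.
Qed.

Lemma csum_app f J J' : csum f (J ++ J') = csum f J + csum f J'.
Proof.
  induction J as [|p J IH]; unfold csum in *; simpl; [ring|rewrite IH; ring].
Qed.

Lemma rsum_app f J J' : rsum f (J ++ J') = (rsum f J + rsum f J')%R.
Proof.
  induction J as [|p J IH]; unfold rsum in *; simpl; [ring|rewrite IH; ring].
Qed.

Lemma rsum_nonneg g J : (forall m n, 0 <= g m n)%R -> (0 <= rsum g J)%R.
Proof.
  intros H; induction J as [|p J IH]; unfold rsum in *; simpl; [lra|].
  specialize (H (fst p) (snd p)); lra.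
Qed.

Lemma Cmod_csum_le f g J :
  (forall m n, Cmod (f m n) <= g m n)%R -> (Cmod (csum f J) <= rsum g J)%R.
Proof.
  intros H; induction J as [|p J IH]; unfold rsum, csum in *; simpl.
  - rewrite Cmod_0; lra.
  - eapply Rle_trans; [apply Cmod_triangle|]. specialize (H (fst p) (snd p)); lra.
Qed.

Lemma rsum_incl g J J' : (forall m n, 0 <= g m n)%R -> NoDup J -> incl J J' ->
  (rsum g J <= rsum g J')%R.
Proof.
  intros Hg Hnd Hin. destruct (NoDup_incl_Permutation J J' Hnd Hin) as [K HK].
  rewrite (rsum_perm _ _ _ HK), rsum_app. pose proof (rsum_nonneg g K Hg); lra.
Qed.

(** The bound is the tail of the full geometric series; the free starting index lets the induction
    shift it by one. *)
Lemma geom_seq_sum (p : R) (a N : nat) : (0 <= p < 1)%R ->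
  (fold_right Rplus 0 (map (pow p) (seq a N)) <= p ^ a / (1 - p))%R.
Proof.
  intros Hp; revert a; induction N as [|N IH]; intros a; simpl.
  - apply Rdiv_le_0_compat; [apply pow_le; lra|lra].
  - specialize (IH (S a)). eapply Rle_trans; [apply Rplus_le_compat_l, IH|].
    right; simpl; field; lra.
Qed.

Lemma rsum_square_mult (u v : nat -> R) l l' :
  rsum (fun m n => u m * v n)%R (list_prod l l')
  = (fold_right Rplus 0 (map u l) * fold_right Rplus 0 (map v l'))%R.
Proof.
  induction l as [|a l IH]; simpl; [unfold rsum; simpl; ring|].
  rewrite rsum_app, IH, Rmult_plus_distr_r. f_equal.
  clear IH; induction l' as [|b l' IH]; unfold rsum in *; simpl; [ring|].
  rewrite IH; ring.
Qed.

Lemma fold_pow_nonneg (p : R) l : (0 <= p)%R ->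
  (0 <= fold_right Rplus 0 (map (pow p) l))%R.
Proof.
  intros Hp; induction l as [|a l IH]; simpl; [lra|].
  pose proof (pow_le p a Hp); lra.
Qed.

Lemma incl_square (J : list (nat * nat)) : exists N, incl J (square N).
Proof.
  induction J as [|[m n] J [N HN]].
  - exists 0%nat; intros u [].
  - exists (m + n + N)%nat; intros [u v] [E|Hu]; apply in_square.
    + injection E as -> ->; lia.
    + apply HN, in_square in Hu; lia.
Qed.

(** The constant does not depend on [J]: every [J] sits in a square, where the double sum factors
    into two geometric sums. *)
Lemma rsum_geom_le (p q : R) J : (0 <= p < 1)%R -> (0 <= q < 1)%R -> NoDup J ->
  (rsum (fun m n => p ^ m * q ^ n) J <= / (1 - p) * / (1 - q))%R.
Proof.
  intros Hp Hq HJ. destruct (incl_square J) as [N HN].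
  eapply Rle_trans; [apply rsum_incl with (J' := square N); auto|].
  - intros m n; apply Rmult_le_pos; apply pow_le; lra.
  - unfold square; rewrite rsum_square_mult.
    apply Rmult_le_compat; try (apply fold_pow_nonneg; lra).
    + eapply Rle_trans; [apply geom_seq_sum; auto|]. simpl; right; field; lra.
    + eapply Rle_trans; [apply geom_seq_sum; auto|]. simpl; right; field; lra.
Qed.

(* The filter along which [is_sum2] takes its limit. *)
Definition exhausting (P : list (nat * nat) -> Prop) : Prop :=
  exists N : nat, forall J, NoDup J ->
    (forall m n : nat, (m <= N)%nat -> (n <= N)%nat -> In (m, n) J) -> P J.

Global Instance exhausting_filter : ProperFilter exhausting.
Proof.
  constructor.
  - intros P [N HN]. exists (square N). apply HN; [apply NoDup_square|].
    intros m n Hm Hn; now apply in_square.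
  - constructor.
    + now exists 0%nat.
    + intros P Q [N HN] [N' HN']. exists (N + N')%nat. intros J HJ HJN.
      split; [apply HN|apply HN']; auto; intros; apply HJN; lia.
    + intros P Q HPQ [N HN]; exists N; auto.
Qed.

(** Both sides agree once norm balls are unfolded; this opens up uniqueness, linearity and Cauchy
    completeness of filter limits. *)
Lemma is_sum2_filterlim (f : nat -> nat -> C) (l : C) :
  is_sum2 f l <->
  filterlim (csum f) exhausting (@locally C_NormedModule l).
Proof.
  split.
  - intros H. apply (proj2 (@filterlim_locally_ball_norm C_AbsRing _ C_NormedModule
      exhausting _ (csum f) l)). exact H.
  - intros H. exact (proj1 (@filterlim_locally_ball_norm C_AbsRing _ C_NormedModule
      exhausting _ (csum f) l) H).
Qed.

Lemma is_sum2_unique f l l' : is_sum2 f l -> is_sum2 f l' -> l = l'.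
Proof.
  rewrite !is_sum2_filterlim. apply (@filterlim_locally_unique _ C_AbsRing C_NormedModule exhausting _).
Qed.

Lemma Sum2_is f l : is_sum2 f l -> Sum2 f = l.
Proof.
  intros H; unfold Sum2. destruct (excluded_middle_informative _) as [E|E].
  - destruct (constructive_indefinite_description _ E) as [l' Hl']; simpl.
    now apply is_sum2_unique with f.
  - exfalso; eauto.
Qed.

Lemma Sum2_correct f : (exists l, is_sum2 f l) -> is_sum2 f (Sum2 f).
Proof.
  intros [l Hl]. now rewrite (Sum2_is f l).
Qed.

Lemma Sum2_diverges f : ~ (exists l, is_sum2 f l) -> Sum2 f = 0.
Proof.
  intros H; unfold Sum2. now destruct (excluded_middle_informative _).
Qed.

Lemma Sum2_ext f g : (forall m n, f m n = g m n) -> Sum2 f = Sum2 g.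
Proof.
  intros H. f_equal. now extensionality m; extensionality n.
Qed.

Lemma is_sum2_plus f g l l' : is_sum2 f l -> is_sum2 g l' ->
  is_sum2 (fun m n => f m n + g m n) (l + l').
Proof.
  rewrite !is_sum2_filterlim. intros Hf Hg.
  apply filterlim_ext with (fun J => plus (csum f J : C_NormedModule) (csum g J)).
  - intros J; change (csum f J + csum g J = csum (fun m n => f m n + g m n) J).
    unfold csum; induction J as [|p J IH]; simpl; [ring|]. rewrite <- IH; ring.
  - eapply filterlim_comp_2; [exact Hf|exact Hg|].
    exact (@filterlim_plus C_AbsRing C_NormedModule l l').
Qed.

Lemma is_sum2_scal k f l : is_sum2 f l -> is_sum2 (fun m n => k * f m n) (k * l).
Proof.
  rewrite !is_sum2_filterlim. intros Hf.
  apply filterlim_ext with (fun J => scal (k : C_AbsRing) (csum f J : C_NormedModule)).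
  - intros J; change (k * csum f J = csum (fun m n => k * f m n) J).
    unfold csum; induction J as [|p J IH]; simpl; [ring|]. rewrite <- IH; ring.
  - eapply filterlim_comp; [exact Hf|].
    exact (@filterlim_scal_r C_AbsRing C_NormedModule k l).
Qed.

(** No convergence is assumed. For [k <> 0] divergence passes from one series to the other, so both
    values are 0; for [k = 0] the left series sums to 0 and the right side vanishes whatever
    [Sum2 f] is. A zero prefactor may thus stand before a divergent shifted series. *)
Lemma Sum2_scal k f : Sum2 (fun m n => k * f m n) = k * Sum2 f.
Proof.
  destruct (classic (exists l, is_sum2 f l)) as [H|H].
  - apply Sum2_is, is_sum2_scal, Sum2_correct, H.
  - rewrite (Sum2_diverges f H), Cmult_0_r. destruct (Ceq_dec k 0) as [->|Hk].
    + apply Sum2_is.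
      assert (H0 : is_sum2 (fun _ _ => 0) 0).
      { intros eps. exists 0%nat. intros J _ _.
        replace (fold_right _ _ _) with (RtoC 0).
        - replace (0 - 0) with (RtoC 0) by ring. rewrite Cmod_0. apply eps.
        - induction J as [|p J IH]; simpl; [easy|rewrite <- IH; ring]. }
      replace (fun m n => 0 * f m n) with (fun _ _ : nat => RtoC 0).
      * exact H0.
      * extensionality m; extensionality n; ring.
    + apply Sum2_diverges. intros [l Hl]. apply H. exists (/ k * l).
      replace f with (fun m n => / k * (k * f m n)).
      * now apply is_sum2_scal with (f := fun m n => k * f m n).
      * extensionality m; extensionality n; field; auto.
Qed.

Lemma Sum2_swap f : Sum2 (fun m n => f n m) = Sum2 f.
Proof.
  assert (key : forall f l, is_sum2 f l -> is_sum2 (fun m n => f n m) l).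
  { intros g l Hg eps. destruct (Hg eps) as [N HN]. exists N. intros J HJ HJN.
    specialize (HN (map (fun p => (snd p, fst p)) J)).
    rewrite map_map in HN. apply HN.
    - apply FinFun.Injective_map_NoDup; auto.
      intros [u v] [u' v'] E; simpl in E; congruence.
    - intros m n Hm Hn. apply in_map_iff. exists (n, m); auto. }
  destruct (classic (exists l, is_sum2 f l)) as [[l H]|H].
  - rewrite (Sum2_is _ _ H). now apply Sum2_is, key.
  - rewrite (Sum2_diverges _ H). apply Sum2_diverges. intros [l Hl].
    apply H; exists l. now apply key in Hl.
Qed.

(** With [S] the supremum of the finite sums of moduli, a finite set whose sum exceeds [S - eps / 2]
    leaves less than [eps / 2] for everything outside it; this gives the Cauchy property along
    [exhausting]. *)
Lemma is_sum2_abs_bounded f (B : R) :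
  (forall J, NoDup J -> rsum (fun m n => Cmod (f m n)) J <= B)%R ->
  exists l, is_sum2 f l /\ (Cmod l <= B)%R.
Proof.
  intros HB.
  set (g := fun m n => Cmod (f m n)) in *.
  destruct (completeness (fun v => exists J, NoDup J /\ v = rsum g J)) as [S [HS1 HS2]].
  - exists B. intros v [J [HJ ->]]; auto.
  - exists (rsum g nil), nil; split; [constructor|easy].
  - assert (HC : exists l : C, filterlim (csum f) exhausting (@locally C_NormedModule l)).
    { apply (filterlim_locally_cauchy (U := C_CompleteNormedModule)).
      intros eps.
      assert (HJ0 : exists J0, NoDup J0 /\ (S - eps / 2 < rsum g J0)%R).
      { apply NNPP. intros Hn. assert (H : (S <= S - eps / 2)%R).
        - apply HS2. intros v [J [HJ ->]]. apply Rnot_lt_le. intros Hlt. apply Hn; eauto.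
        - destruct eps as [e He]; simpl in *; lra. }
      destruct HJ0 as [J0 [HJ0 Hs]]. destruct (incl_square J0) as [N HN].
      exists (fun J => Cmod (csum f J - csum f J0) < eps / 2)%R. split.
      - exists N. intros J HJ HJN.
        destruct (NoDup_incl_Permutation J0 J HJ0) as [J' HJ'].
        { intros [m n] Hmn. apply HN, in_square in Hmn. apply HJN; tauto. }
        rewrite (csum_perm _ _ _ HJ'), csum_app.
        replace (csum f J0 + csum f J' - csum f J0) with (csum f J') by ring.
        apply Rle_lt_trans with (rsum g J').
        + apply Cmod_csum_le; intros; unfold g; lra.
        + assert (rsum g (J0 ++ J') <= S)%R.
          { apply HS1. exists (J0 ++ J'); split; auto. now apply Permutation_NoDup with J. }
          rewrite rsum_app in H. lra.
      - intros u v Hu Hv. apply (@norm_compat1 C_AbsRing C_NormedModule).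
        change (Cmod (csum f v - csum f u) < eps)%R.
        replace (csum f v - csum f u) with
          ((csum f v - csum f J0) + (- (csum f u - csum f J0))) by ring.
        eapply Rle_lt_trans; [apply Cmod_triangle|]. rewrite Cmod_opp. lra. }
    destruct HC as [l Hl]. exists l. apply is_sum2_filterlim in Hl. split; auto.
    (* The bound passes to the limit: otherwise a square sum within [Cmod l - B] of [l] would have
       modulus exceeding [B]. *)
    apply Rnot_lt_le. intros Hlt.
    assert (He : (0 < Cmod l - B)%R) by lra.
    destruct (Hl (mkposreal _ He)) as [N HN]. simpl in HN.
    specialize (HN (square N) (NoDup_square N)).
    assert (H := HN (fun m n Hm Hn => proj2 (in_square N m n) (conj Hm Hn))).
    fold (csum f (square N)) in H.
    assert (H2 : (Cmod (csum f (square N)) <= B)%R).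
    { eapply Rle_trans; [apply Cmod_csum_le with (g := g); intros; unfold g; lra|].
      apply HB, NoDup_square. }
    assert (H3 := Cmod_triangle (csum f (square N)) (- (csum f (square N) - l))).
    rewrite Cmod_opp in H3.
    replace (csum f (square N) + - (csum f (square N) - l)) with l in H3 by ring. lra.
Qed.

Lemma is_sum2_geom_dominated f (M p q : R) :
  (0 <= p < 1)%R -> (0 <= q < 1)%R ->
  (forall m n, Cmod (f m n) <= M * (p ^ m * q ^ n))%R ->
  exists l, is_sum2 f l /\ (Cmod l <= M * (/ (1 - p) * / (1 - q)))%R.
Proof.
  intros Hp Hq Hf. apply is_sum2_abs_bounded. intros J HJ.
  assert (HM : (0 <= M)%R).
  { specialize (Hf 0%nat 0%nat); simpl in Hf. pose proof (Cmod_ge_0 (f 0%nat 0%nat)); lra. }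
  apply Rle_trans with (M * rsum (fun m n => p ^ m * q ^ n) J)%R.
  - clear HJ. induction J as [|a J IH]; unfold rsum in *; simpl; [lra|].
    specialize (Hf (fst a) (snd a)). lra.
  - apply Rmult_le_compat_l; auto. now apply rsum_geom_le.
Qed.

(** Used in contrapositive form to prove divergence. Adding one new index to a large square changes
    the sum by one term, and both sums lie within 1 of the limit; hence the margin 2. *)
Lemma is_sum2_terms_bounded f l : is_sum2 f l ->
  exists M : R, forall m n, (Cmod (f m n) <= M)%R.
Proof.
  intros H. destruct (H (mkposreal 1 Rlt_0_1)) as [N HN]. simpl in HN.
  set (g := fun m n => Cmod (f m n)).
  exists (rsum g (square N) + 2)%R. intros m n.
  assert (Hg : forall m n, (0 <= g m n)%R) by (intros; apply Cmod_ge_0).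
  destruct (classic (In (m, n) (square N))) as [Hin|Hout].
  - assert (H1 : (rsum g ((m, n) :: nil) <= rsum g (square N))%R).
    { apply rsum_incl; auto.
      - constructor; [easy|constructor].
      - intros u [<-|[]]; auto. }
    unfold rsum at 1 in H1; simpl in H1. fold (g m n). lra.
  - assert (Hsq : forall m n, (m <= N)%nat -> (n <= N)%nat -> In (m, n) (square N)).
    { intros; now apply in_square. }
    assert (H1 := HN _ (NoDup_square N) Hsq).
    assert (H2 := HN ((m, n) :: square N) (NoDup_cons _ Hout (NoDup_square N))
      (fun a b Ha Hb => or_intror (Hsq a b Ha Hb))).
    change (Cmod (f m n + csum f (square N) - l) < 1)%R in H2.
    fold (csum f (square N)) in H1.
    pose proof (rsum_nonneg g (square N) Hg).
    assert (H3 := Cmod_triangle (f m n + csum f (square N) - l)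
      (- (csum f (square N) - l))). rewrite Cmod_opp in H3.
    replace (f m n + csum f (square N) - l + - (csum f (square N) - l)) with (f m n)
      in H3 by ring. lra.
Qed.

(** * Complex derivatives, exponential and powers *)

(* Stronger than differentiability: quadratic remainders can be summed term by term. *)
Definition quad_derive (f : C -> C) (z l : C) : Prop :=
  exists K d : R, (0 < d)%R /\ (0 <= K)%R /\ forall h : C, (Cmod h < d)%R ->
    (Cmod (f (z + h)%C - f z - h * l)%C <= K * Cmod h ^ 2)%R.

Lemma quad_derive_is_derive f z l : quad_derive f z l ->
  is_derive (K := C_AbsRing) (V := C_NormedModule) f z l.
Proof.
  intros [K [d [Hd [HK H]]]]. split.
  - apply (@is_linear_scal_l C_AbsRing C_NormedModule l).
  - intros x Hx. apply (@is_filter_lim_locally_unique C_AbsRing (AbsRing_NormedModule C_AbsRing) z x) in Hx. subst x.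
    intros [e He]. simpl.
    (* The [+ 1] covers [K = 0]. *)
    assert (Hde : (0 < Rmin d (e / (K + 1)))%R).
    { apply Rmin_pos; auto. apply Rdiv_lt_0_compat; lra. }
    exists (mkposreal _ Hde).
    enough (HC : forall y : C, (Cmod (y - z) < Rmin d (e / (K + 1)))%R ->
      (Cmod (f y - f z - (y - z) * l) <= e * Cmod (y - z))%R) by exact HC.
    intros y Hy. specialize (H (y - z)). replace (z + (y - z)) with y in H by ring.
    assert (H1 := Rmin_l d (e / (K + 1))). assert (H2 := Rmin_r d (e / (K + 1))).
    eapply Rle_trans; [apply H; lra|].
    replace (K * Cmod (y - z) ^ 2)%R with (K * Cmod (y - z) * Cmod (y - z))%R by ring.
    apply Rmult_le_compat_r; [apply Cmod_ge_0|].
    assert (H3 := Cmod_ge_0 (y - z)).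
    apply Rle_trans with ((K + 1) * (e / (K + 1)))%R.
    + apply Rmult_le_compat; lra.
    + right; field; lra.
Qed.

(** With [u] and [v] the two remainders, that of the product is [u * g (z + h)] plus
    [h * l * (h * l' + v)] plus [f z * v], each quadratic in [h]. *)
Lemma quad_derive_mult f g z l l' : quad_derive f z l -> quad_derive g z l' ->
  quad_derive (fun w => f w * g w) z (l * g z + f z * l').
Proof.
  intros [K [d [Hd [HK Hf]]]] [K' [d' [Hd' [HK' Hg]]]].
  (* The bound 1 gives [Cmod h ^ 2 <= Cmod h], so a quadratic remainder also counts as a linear
     one. *)
  set (D := Rmin 1 (Rmin d d')).
  assert (HD : (0 < D /\ D <= 1 /\ D <= d /\ D <= d')%R).
  { unfold D. pose proof (Rmin_l 1 (Rmin d d')). pose proof (Rmin_r 1 (Rmin d d')).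
    pose proof (Rmin_l d d'). pose proof (Rmin_r d d').
    repeat split; try lra. repeat apply Rmin_pos; lra. }
  exists (K * (Cmod (g z) + Cmod l' + K') + Cmod l * (Cmod l' + K') + Cmod (f z) * K')%R, D.
  assert (Hl := Cmod_ge_0 l). assert (Hl' := Cmod_ge_0 l').
  assert (Hfz := Cmod_ge_0 (f z)). assert (Hgz := Cmod_ge_0 (g z)).
  split; [lra|]. split.
  { repeat apply Rplus_le_le_0_compat; apply Rmult_le_pos; lra. }
  intros h Hh. specialize (Hf h ltac:(lra)). specialize (Hg h ltac:(lra)).
  set (u := f (z + h) - f z - h * l) in *. set (v := g (z + h) - g z - h * l') in *.
  replace (f (z + h) * g (z + h) - f z * g z - h * (l * g z + f z * l')) with
    (u * (g z + (h * l' + v)) + (h * l * (h * l' + v) + f z * v)) by (unfold u, v; ring).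
  assert (Hh0 := Cmod_ge_0 h).
  assert (Hh2 : (Cmod h ^ 2 <= Cmod h)%R) by nra.
  assert (Hhv : (Cmod (h * l' + v) <= Cmod h * (Cmod l' + K'))%R).
  { eapply Rle_trans; [apply Cmod_triangle|]. rewrite Cmod_mult. nra. }
  assert (H1 : (Cmod (u * (g z + (h * l' + v))) <=
    K * Cmod h ^ 2 * (Cmod (g z) + Cmod l' + K'))%R).
  { rewrite Cmod_mult. apply Rmult_le_compat; auto using Cmod_ge_0.
    eapply Rle_trans; [apply Cmod_triangle|]. nra. }
  assert (H2 : (Cmod (h * l * (h * l' + v)) <= Cmod h ^ 2 * (Cmod l * (Cmod l' + K')))%R).
  { rewrite !Cmod_mult.
    apply Rle_trans with (Cmod h * Cmod l * (Cmod h * (Cmod l' + K')))%R; [|right; ring].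
    apply Rmult_le_compat_l; auto. now apply Rmult_le_pos. }
  assert (H3 : (Cmod (f z * v) <= Cmod (f z) * (K' * Cmod h ^ 2))%R).
  { rewrite Cmod_mult. now apply Rmult_le_compat_l. }
  eapply Rle_trans; [apply Cmod_triangle|].
  eapply Rle_trans; [apply Rplus_le_compat_l, Cmod_triangle|]. lra.
Qed.

(** Balls of the product uniform structure are boxes; a box of half-width [d / 2] fits into the disc
    of radius [d]. *)
Lemma locally_C_Cmod (z : C) (P : C -> Prop) :
  @locally C_UniformSpace z P <->
  exists d : R, (0 < d)%R /\ forall w, (Cmod (w - z) < d)%R -> P w.
Proof.
  split.
  - intros [e He]. exists e. split; [apply cond_pos|]. intros w Hw. apply He.
    apply (@norm_compat1 C_AbsRing C_NormedModule). exact Hw.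
  - intros [d [Hd H]]. assert (Hd2 : (0 < d / 2)%R) by lra.
    exists (mkposreal _ Hd2). intros w [H1 H2]. apply H.
    change (Rabs (Re w - Re z) < d / 2)%R in H1. change (Rabs (Im w - Im z) < d / 2)%R in H2.
    replace (w - z) with (((Re w - Re z)%R, 0%R) + (0%R, (Im w - Im z)%R)) by
      (destruct w, z; unfold Cminus, Cplus; simpl; f_equal; ring).
    eapply Rle_lt_trans; [apply Cmod_triangle|].
    replace (Cmod (Re w - Re z, 0)%R) with (Rabs (Re w - Re z)).
    2:{ unfold Cmod; simpl. rewrite <- sqrt_Rsqr_abs. f_equal. unfold Rsqr; ring. }
    replace (Cmod (0, Im w - Im z)%R) with (Rabs (Im w - Im z)).
    2:{ unfold Cmod; simpl. rewrite <- sqrt_Rsqr_abs. f_equal. unfold Rsqr; ring. }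
    lra.
Qed.

(** * Quadratic remainders of the exponential, the logarithm and powers *)

Lemma Cexp_plus u v : Cexp (u + v) = Cexp u * Cexp v.
Proof.
  unfold Cexp. rewrite re_plus, im_plus, exp_plus, cos_plus, sin_plus.
  unfold Cmult; simpl. f_equal; ring.
Qed.

Lemma Cexp_0 : Cexp 0 = 1.
Proof.
  unfold Cexp; simpl. rewrite exp_0, cos_0, sin_0. unfold RtoC; f_equal; ring.
Qed.

Lemma Cexp_neq_0 z : Cexp z <> 0.
Proof.
  intros H. assert (H1 := Cexp_plus z (- z)). rewrite H in H1.
  replace (z + - z) with (RtoC 0) in H1 by ring. rewrite Cexp_0, Cmult_0_l in H1.
  now apply C1_nz.
Qed.

(** Applying [1 + u <= exp u] to [- u] gives [exp u <= 1 / (1 - u)], and [(1 + u + 2 * u ^ 2) * (1 -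
    u) = 1 + u ^ 2 * (1 - 2 * u)] is at least 1 for [u <= 1 / 2]. *)
Lemma exp_quad u : (Rabs u <= 1 / 2)%R -> (0 <= exp u - 1 - u <= 2 * u ^ 2)%R.
Proof.
  intros Hu. apply Rabs_le_between in Hu.
  assert (H1 := exp_ineq1_le u). assert (H2 := exp_ineq1_le (- u)). split; [lra|].
  assert (H3 : (exp u * exp (- u) = 1)%R) by (rewrite <- exp_plus, Rplus_opp_r; apply exp_0).
  assert (H4 := exp_pos u).
  assert (H5 : (exp u * (1 - u) <= 1)%R) by nra.
  assert (H6 : (exp u <= (1 + u + 2 * u ^ 2))%R).
  { apply Rmult_le_reg_r with (1 - u)%R; [lra|]. nra. }
  lra.
Qed.

Lemma sin_abs_le v : (Rabs (sin v) <= Rabs v)%R.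
Proof.
  assert (H : forall t, (0 <= t -> Rabs (sin t) <= t)%R).
  { intros t Ht. destruct (Rle_lt_dec t 1) as [H1|H1].
    - destruct (Req_dec t 0) as [->|H0]; [rewrite sin_0, Rabs_R0; lra|].
      assert (H2 := sin_lt_x t ltac:(lra)).
      rewrite Rabs_pos_eq; [lra|]. apply sin_ge_0; [lra|]. pose proof PI2_1; lra.
    - pose proof (SIN_bound t). apply Rabs_le; lra. }
  destruct (Rle_lt_dec 0 v) as [Hv|Hv].
  - rewrite (Rabs_pos_eq v); auto.
  - rewrite (Rabs_left v) by auto. rewrite <- Rabs_Ropp, <- sin_neg. apply H; lra.
Qed.

Lemma cos_quad v : (Rabs (cos v - 1) <= v ^ 2 / 2)%R.
Proof.
  replace (cos v) with (cos (2 * (v / 2))) by (f_equal; field).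
  rewrite cos_2a_sin. assert (H := sin_abs_le (v / 2)).
  apply Rsqr_le_abs_1 in H. rewrite Rabs_left1.
  - unfold Rsqr in H. nra.
  - nra.
Qed.

(** By the mean value theorem the remainder is [(cos t - 1) * v] with [t] between 0 and [v], hence
    at most [v ^ 2 / 2] times [Rabs v <= 1]. *)
Lemma sin_quad v : (Rabs v <= 1)%R -> (Rabs (sin v - v) <= v ^ 2)%R.
Proof.
  intros Hv.
  destruct (MVT_gen (fun t => (sin t - t)%R) 0 v (fun t => (cos t - 1)%R)) as [t [Ht E]].
  - intros t _. auto_derive; auto; ring.
  - intros t _. apply continuity_pt_minus; [apply continuity_sin|apply derivable_continuous_pt, derivable_pt_id].
  - rewrite sin_0, Rminus_0_r, Rminus_0_r in E. rewrite Rminus_0_r in E. rewrite E, Rabs_mult.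
    assert (H1 := cos_quad t).
    assert (H2 : (Rabs t <= Rabs v)%R).
    { unfold Rmin, Rmax in Ht. destruct (Rle_dec 0 v).
      - rewrite !Rabs_pos_eq; lra.
      - rewrite !Rabs_left1; lra. }
    rewrite <- (pow2_abs v). rewrite <- (pow2_abs t) in H1.
    pose proof (Rabs_pos t). pose proof (Rabs_pos v). nra.
Qed.

(** The remainder splits into four real quantities; with [A = Cmod k] the cosine one is at most
    [A ^ 2] and each other one at most [2 * A ^ 2], so 10 leaves room. *)
Lemma Cexp_quad (k : C) : (Cmod k <= 1 / 2)%R ->
  (Cmod (Cexp k - 1 - k) <= 10 * Cmod k ^ 2)%R.
Proof.
  intros Hk. destruct k as [u v].
  assert (Hu : (Rabs u <= Cmod (u, v))%R).
  { eapply Rle_trans; [|apply Rmax_Cmod]. apply Rmax_l. }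
  assert (Hv : (Rabs v <= Cmod (u, v))%R).
  { eapply Rle_trans; [|apply Rmax_Cmod]. apply Rmax_r. }
  set (A := Cmod (u, v)) in *.
  assert (H1 := exp_quad u ltac:(lra)).
  assert (H2 := cos_quad v). assert (H3 := sin_quad v ltac:(lra)).
  assert (HA : (0 <= A)%R) by apply Cmod_ge_0.
  assert (Hu2 : (u ^ 2 <= A ^ 2)%R).
  { rewrite <- (pow2_abs u). apply pow_incr; split; auto using Rabs_pos. }
  assert (Hv2 : (v ^ 2 <= A ^ 2)%R).
  { rewrite <- (pow2_abs v). apply pow_incr; split; auto using Rabs_pos. }
  assert (Hex : (0 < exp u <= 2)%R).
  { split; [apply exp_pos|]. apply Rabs_le_between in Hu. nra. }
  set (E := exp u) in *.
  replace (Cexp (u, v) - 1 - (u, v)) with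
    ((((E * (cos v - 1))%R, (E * (sin v - v))%R) +
     (((E - 1 - u)%R, ((E - 1) * v)%R)))).
  2:{ unfold Cexp, Cminus, Cplus, Copp, RtoC; simpl. fold E. f_equal; ring. }
  assert (HC : forall x y, (Cmod (x, y) <= Rabs x + Rabs y)%R).
  { intros x y. replace (x, y) with ((x, 0%R) + (0%R, y)) by
      (unfold Cplus; simpl; f_equal; ring).
    eapply Rle_trans; [apply Cmod_triangle|]. right. f_equal; unfold Cmod; simpl;
    rewrite <- sqrt_Rsqr_abs; f_equal; unfold Rsqr; ring. }
  eapply Rle_trans; [apply Cmod_triangle|].
  assert (Ha := HC (E * (cos v - 1))%R (E * (sin v - v))%R).
  assert (Hb := HC (E - 1 - u)%R ((E - 1) * v)%R).
  rewrite Rabs_mult, (Rabs_mult E (sin v - v)) in Ha. rewrite (Rabs_mult (E - 1) v) in Hb.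
  rewrite (Rabs_pos_eq E) in Ha by lra.
  rewrite (Rabs_pos_eq (E - 1 - u)) in Hb by lra.
  assert (H4 : (Rabs (E - 1) <= 2 * A)%R).
  { apply Rabs_le_between in Hu. apply Rabs_le. nra. }
  assert (H5 : (Rabs (E - 1) * Rabs v <= 2 * A * A)%R).
  { apply Rmult_le_compat; auto using Rabs_pos. }
  assert (H6 : (E * Rabs (cos v - 1) <= 2 * (A ^ 2 / 2))%R).
  { apply Rmult_le_compat; auto using Rabs_pos; lra. }
  assert (H7 : (E * Rabs (sin v - v) <= 2 * (A ^ 2))%R).
  { apply Rmult_le_compat; auto using Rabs_pos; lra. }
  pose proof (pow2_ge_0 A). simpl in *. lra.
Qed.

Lemma log_branch_neq_0 L x : is_log_branch L x -> x <> 0.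
Proof.
  intros H. apply locally_singleton in H. destruct H as [_ <-]. apply Cexp_neq_0.
Qed.

(* With [k = L (z + h) - L z] one has [Cexp k = 1 + h / z], so the continuity of [L]
   makes [k] small and [k - h / z] quadratic in [h]. *)
Lemma log_branch_quad L z : is_log_branch L z -> quad_derive L z (/ z).
Proof.
  intros H. assert (Hz := log_branch_neq_0 _ _ H).
  assert (Hz1 := Cmod_gt_0 z). assert (Hz0 : (0 < Cmod z)%R) by (now apply Hz1).
  assert (H0 := locally_singleton _ _ H). destruct H0 as [Hc He].
  apply locally_C_Cmod in H. destruct H as [d [Hd H]].
  (* [Cmod k < 1 / 20] makes [10 * Cmod k ^ 2] at most [Cmod k / 2], so that [Cexp k - 1 = h / z]
     forces [Cmod k <= 2 * Cmod (h / z)]. The constant 40 below is [10 * 2 ^ 2]. *)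
  assert (Hn : locally (L z) (fun w => Cmod (w - L z) < 1 / 20)%R).
  { apply locally_C_Cmod. exists (1 / 20)%R; split; [lra|auto]. }
  apply Hc in Hn. apply locally_C_Cmod in Hn. destruct Hn as [d' [Hd' Hn]].
  exists (40 / Cmod z ^ 2)%R, (Rmin d d'). split; [now apply Rmin_pos|]. split.
  { apply Rdiv_le_0_compat; [lra|]. now apply pow_lt. }
  intros h Hh. pose proof (Rmin_l d d'). pose proof (Rmin_r d d').
  specialize (H (z + h)). specialize (Hn (z + h)).
  replace (z + h - z) with h in * by ring.
  specialize (Hn ltac:(lra)). destruct (H ltac:(lra)) as [_ He'].
  set (k := L (z + h) - L z) in *.
  assert (Hk : Cexp k - 1 = h / z).
  { assert (E : Cexp (L (z + h)) = Cexp (L z) * Cexp k).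
    { rewrite <- Cexp_plus. f_equal. unfold k; ring. }
    rewrite He, He' in E. replace (Cexp k) with ((z + h) / z) by (rewrite E; now field).
    now field. }
  assert (Hq := Cexp_quad k ltac:(lra)). rewrite Hk in Hq.
  assert (Hk0 := Cmod_ge_0 k).
  assert (Hk2 : (Cmod k <= 2 * Cmod (h / z))%R).
  { assert (Ht := Cmod_triangle (h / z) (- (h / z - k))). rewrite Cmod_opp in Ht.
    replace (h / z + - (h / z - k)) with k in Ht by ring. nra. }
  fold (h / z). replace (k - h / z) with (- (h / z - k)) by ring. rewrite Cmod_opp.
  eapply Rle_trans; [exact Hq|].
  apply Rle_trans with (10 * (2 * Cmod (h / z)) ^ 2)%R.
  - apply Rmult_le_compat_l; [lra|]. apply pow_incr; lra.
  - rewrite Cmod_div by auto. right. field. lra.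
Qed.

(** With [k = L (z + h) - L z = h / z + q] and [q] quadratic, [cpow L s (z + h)] is
    [cpow L s z * Cexp (s * k)]; the remainder comes from that of [Cexp] at [s * k] and from
    [s * q]. *)
Lemma cpow_quad L s z : is_log_branch L z ->
  quad_derive (cpow L s) z (s * cpow L (s - 1) z).
Proof.
  intros H. assert (Hz := log_branch_neq_0 _ _ H).
  assert (He : Cexp (L z) = z) by (now apply locally_singleton in H).
  destruct (log_branch_quad L z H) as [K [d [Hd [HK HL]]]].
  set (A := (Cmod (/ z) + K)%R).
  assert (HA : (0 <= A)%R) by (unfold A; pose proof (Cmod_ge_0 (/ z)); lra).
  assert (Hs := Cmod_ge_0 s).
  set (B := (Cmod s * A)%R). assert (HB : (0 <= B)%R) by (now apply Rmult_le_pos).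
  assert (Hp := Cmod_ge_0 (cpow L s z)).
  (* The radius [/ (2 * (B + 1))] ensures [Cmod (s * k) <= B * Cmod h <= 1 / 2], the range of
     [Cexp_quad]. *)
  exists (Cmod (cpow L s z) * (10 * B ^ 2 + Cmod s * K))%R,
    (Rmin (Rmin d 1) (/ (2 * (B + 1)))).
  split.
  { repeat apply Rmin_pos; try lra. apply Rinv_0_lt_compat; lra. }
  split.
  { apply Rmult_le_pos; auto. apply Rplus_le_le_0_compat; [nra|now apply Rmult_le_pos]. }
  intros h Hh.
  pose proof (Rmin_l (Rmin d 1) (/ (2 * (B + 1)))).
  pose proof (Rmin_r (Rmin d 1) (/ (2 * (B + 1)))).
  pose proof (Rmin_l d 1). pose proof (Rmin_r d 1).
  specialize (HL h ltac:(lra)). assert (Hh0 := Cmod_ge_0 h).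
  set (k := L (z + h) - L z) in *. set (q := k - h * / z) in *.
  assert (Hk : (Cmod k <= A * Cmod h)%R).
  { replace k with (h * / z + q) by (unfold q; ring).
    eapply Rle_trans; [apply Cmod_triangle|]. rewrite Cmod_mult. unfold A.
    assert (Cmod h ^ 2 <= Cmod h)%R by nra. nra. }
  assert (Hsk : (Cmod (s * k) <= B * Cmod h)%R).
  { rewrite Cmod_mult. unfold B. nra. }
  assert (Hsk2 : (Cmod (s * k) <= 1 / 2)%R).
  { apply Rle_trans with ((B + 1) * / (2 * (B + 1)))%R; [|right; field; lra].
    eapply Rle_trans; [exact Hsk|]. apply Rmult_le_compat; lra. }
  assert (Hq := Cexp_quad _ Hsk2).
  unfold cpow at 1. replace (s * L (z + h)) with (s * L z + s * k) by (unfold k; ring).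
  rewrite Cexp_plus. fold (cpow L s z).
  replace (cpow L (s - 1) z) with (cpow L s z * / z).
  2:{ unfold cpow. replace (s * L z) with ((s - 1) * L z + L z) by ring.
      rewrite Cexp_plus, He. now field. }
  replace (cpow L s z * Cexp (s * k) - cpow L s z - h * (s * (cpow L s z * / z))) with
    (cpow L s z * ((Cexp (s * k) - 1 - s * k) + s * q)) by (unfold q; ring).
  rewrite Cmod_mult, Rmult_assoc. apply Rmult_le_compat_l; auto.
  eapply Rle_trans; [apply Cmod_triangle|]. rewrite (Cmod_mult s q).
  assert (H5 : (Cmod (s * k) ^ 2 <= (B * Cmod h) ^ 2)%R).
  { apply pow_incr; split; auto using Cmod_ge_0. }
  assert (H6 : (Cmod s * Cmod q <= Cmod s * (K * Cmod h ^ 2))%R).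
  { now apply Rmult_le_compat_l. }
  nra.
Qed.

(** * Termwise differentiation *)

(** Equivalently, the power series with coefficients [u] has radius of convergence at least 1. *)
Definition subexp (u : nat -> C) : Prop :=
  forall q : R, (1 < q)%R -> exists M : R, (0 <= M)%R /\
    forall n, (Cmod (u n) <= M * q ^ n)%R.

(** A ratio test without quotients, so that [u] may vanish; the finitely many terms up to [N] only
    enlarge [M]. *)
Lemma subexp_ratio u :
  (forall q : R, (1 < q)%R -> exists N, forall n, (N <= n)%nat ->
    (Cmod (u (S n)) <= q * Cmod (u n))%R) -> subexp u.
Proof.
  intros H q Hq. destruct (H q Hq) as [N HN].
  assert (H1 : forall k, exists M : R, (0 <= M)%R /\
    forall n, (n <= k)%nat -> (Cmod (u n) <= M * q ^ n)%R).
  { induction k as [|k [M [HM IH]]].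
    - exists (Cmod (u 0%nat)); split; [apply Cmod_ge_0|]. intros n Hn.
      replace n with 0%nat by lia. simpl; lra.
    - exists (M + Cmod (u (S k)))%R. assert (Hc := Cmod_ge_0 (u (S k))).
      split; [lra|]. intros n Hn. assert (Hqn := pow_R1_Rle q n ltac:(lra)).
      destruct (Nat.eq_dec n (S k)) as [->|Hne].
      + nra.
      + specialize (IH n ltac:(lia)). nra. }
  destruct (H1 N) as [M [HM HMN]]. exists M; split; auto. intros n.
  destruct (Nat.le_gt_cases n N) as [Hn|Hn]; auto.
  replace n with (N + (n - N))%nat by lia. generalize (n - N)%nat. clear n Hn.
  induction n as [|n IH]; [rewrite Nat.add_0_r; apply HMN; lia|].
  rewrite Nat.add_succ_r. eapply Rle_trans; [apply HN; lia|]. simpl.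
  replace (M * (q * q ^ (N + n)))%R with (q * (M * q ^ (N + n)))%R by ring.
  apply Rmult_le_compat_l; lra.
Qed.

Lemma subexp_eventually_0 (u : nat -> C) K : (forall n, (K <= n)%nat -> u n = 0) -> subexp u.
Proof.
  intros H. apply subexp_ratio. intros q Hq; exists K; intros n Hn.
  rewrite !H by lia. rewrite Cmod_0; lra.
Qed.

Lemma Cmod_INR n : Cmod (RtoC (INR n)) = INR n.
Proof. rewrite Cmod_R, Rabs_pos_eq; auto using pos_INR. Qed.

Lemma Cmod_shift_ge (u : C) n : (INR n - Cmod u <= Cmod (u + INR n))%R.
Proof.
  assert (H := Cmod_triangle (u + INR n) (- u)). rewrite Cmod_opp in H.
  replace (u + INR n + - u) with (RtoC (INR n)) in H by ring.
  rewrite Cmod_INR in H. lra.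
Qed.

Lemma INR_eventually_ge (x : R) : exists N, forall n, (N <= n)%nat -> (x <= INR n)%R.
Proof.
  destruct (nfloor_ex (Rmax 0 x) (Rmax_l _ _)) as [N [_ HN]]. exists (S N). intros n Hn.
  apply le_INR in Hn. rewrite S_INR in Hn. pose proof (Rmax_r 0 x). lra.
Qed.

(** The quotient of [u + n] by [v + n] tends to 1: beyond the threshold,
    [Cmod (u - v) <= (q - 1) * Cmod (v + n)]. *)
Lemma shift_ratio (u v : C) (q : R) : (1 < q)%R -> exists N, forall n, (N <= n)%nat ->
  (Cmod (u + INR n) <= q * Cmod (v + INR n))%R.
Proof.
  intros Hq. destruct (INR_eventually_ge (Cmod v + Cmod (u - v) / (q - 1))) as [N HN].
  exists N. intros n Hn. specialize (HN n Hn). assert (Hv := Cmod_shift_ge v n).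
  replace (u + INR n) with ((v + INR n) + (u - v)) by ring.
  eapply Rle_trans; [apply Cmod_triangle|].
  assert (H : (Cmod (u - v) <= (q - 1) * Cmod (v + INR n))%R).
  { apply Rle_trans with ((q - 1) * (Cmod (u - v) / (q - 1)))%R.
    - right; field; lra.
    - apply Rmult_le_compat_l; lra. }
  lra.
Qed.

Lemma subexp_affine (s : C) : subexp (fun n => s + INR n).
Proof.
  apply subexp_ratio. intros q Hq. destruct (shift_ratio (s + 1) s q Hq) as [N HN].
  exists N; intros n Hn. rewrite S_INR, RtoC_plus.
  replace (s + (INR n + 1)) with (s + 1 + INR n) by ring. auto.
Qed.

(* A form of absolute convergence of [psum w B z] for [Cmod z < R0] which is stable under
   multiplication of the coefficients by polynomials in [w]. *)
Definition good (w : nat -> nat -> nat) (B : nat -> nat -> C) (R0 : R) : Prop :=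
  forall rho : R, (0 <= rho < R0)%R -> exists M p q : R,
    (0 <= p < 1)%R /\ (0 <= q < 1)%R /\
    forall m n, (Cmod (B m n) * rho ^ w m n <= M * (p ^ m * q ^ n))%R.

Definition psum (w : nat -> nat -> nat) (B : nat -> nat -> C) (z : C) : C :=
  Sum2 (fun m n => B m n * z ^ w m n).

Lemma good_ext w B B' R0 : (forall m n, B m n = B' m n) -> good w B R0 -> good w B' R0.
Proof.
  intros E H. replace B' with B; auto. now extensionality m; extensionality n.
Qed.

(** The slack between [rho] and [R0] pays for the new factor: raising the radius from [r1] to [r2]
    gains [(r2 / r1) ^ w m n], which dominates an affine function of [w m n]. [r1] replaces [rho],
    which may be 0. *)
Lemma good_affine w B R0 s :
  good w B R0 -> good w (fun m n => B m n * (s + INR (w m n))) R0.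
Proof.
  intros H rho Hrho.
  set (r1 := ((2 * rho + R0) / 3)%R). set (r2 := ((rho + 2 * R0) / 3)%R).
  assert (Hr : (rho <= r1 /\ 0 < r1 /\ r1 < r2 /\ r2 < R0)%R) by (unfold r1, r2; lra).
  destruct (H r2 ltac:(lra)) as [M [p [q [Hp [Hq HB]]]]].
  destruct (subexp_affine s (r2 / r1)%R) as [K [HK Hs]].
  { apply Rmult_lt_reg_r with r1; [lra|]. unfold Rdiv.
    rewrite Rmult_assoc, Rinv_l, Rmult_1_r; lra. }
  exists (K * M)%R, p, q. repeat (split; try tauto). intros m n.
  rewrite Cmod_mult.
  apply Rle_trans with (K * (Cmod (B m n) * r2 ^ w m n))%R.
  2:{ rewrite Rmult_assoc. now apply Rmult_le_compat_l. }
  apply Rle_trans with (Cmod (B m n) * (K * (r2 / r1) ^ w m n) * r1 ^ w m n)%R.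
  - apply Rmult_le_compat.
    + apply Rmult_le_pos; apply Cmod_ge_0.
    + apply pow_le; lra.
    + apply Rmult_le_compat_l; [apply Cmod_ge_0|apply Hs].
    + apply pow_incr; lra.
  - right. replace (r2 ^ w m n)%R with ((r2 / r1 * r1) ^ w m n)%R by (f_equal; field; lra).
    rewrite Rpow_mult_distr. ring.
Qed.

Lemma good_INR w B R0 : good w B R0 -> good w (fun m n => B m n * INR (w m n)) R0.
Proof.
  intros H. apply (good_affine _ _ _ 0) in H. revert H. apply good_ext; intros; ring.
Qed.

Lemma good_is_sum2 w B R0 z : good w B R0 -> (Cmod z < R0)%R ->
  is_sum2 (fun m n => B m n * z ^ w m n) (psum w B z).
Proof.
  intros H Hz. apply Sum2_correct.
  destruct (H (Cmod z)) as [M [p [q [Hp [Hq HB]]]]]; [split; auto using Cmod_ge_0|].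
  destruct (is_sum2_geom_dominated (fun m n => B m n * z ^ w m n) M p q Hp Hq)
    as [l [Hl _]]; eauto.
  intros m n. now rewrite Cmod_mult, Cmod_pow.
Qed.

(** The remainder at [n + 1] is [z + h] times the remainder at [n], plus [n * h ^ 2 * (z ^ n / z)],
    and [n ^ 2 + n <= (n + 1) ^ 2]. Writing the derivative as [n * z ^ n / z] avoids a truncated
    exponent at [n = 0]. *)
Lemma pow_diff_quad (z h : C) (rho : R) n : z <> 0 -> (0 < rho)%R ->
  (Cmod z + Cmod h <= rho)%R ->
  (Cmod ((z + h) ^ n - z ^ n - h / z * (INR n * z ^ n))
   <= Cmod h ^ 2 * (INR n ^ 2 * (rho ^ n / rho ^ 2)))%R.
Proof.
  intros Hz Hr Hh.
  assert (Hz0 := Cmod_ge_0 z). assert (Hh0 := Cmod_ge_0 h).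
  induction n as [|n IH].
  - simpl. replace (1 - 1 - h / z * (0 * 1)) with (RtoC 0) by ring.
    rewrite Cmod_0. right; field; lra.
  - set (E := (z + h) ^ n - z ^ n - h / z * (INR n * z ^ n)) in *.
    replace ((z + h) ^ S n - z ^ S n - h / z * (INR (S n) * z ^ S n)) with
      ((z + h) * E + INR n * h ^ 2 * (z ^ n / z)).
    2:{ unfold E. rewrite S_INR, RtoC_plus. simpl. now field. }
    assert (H1 : (Cmod ((z + h) * E) <= rho * (Cmod h ^ 2 * (INR n ^ 2 * (rho ^ n / rho ^ 2))))%R).
    { rewrite Cmod_mult. apply Rmult_le_compat; auto using Cmod_ge_0.
      eapply Rle_trans; [apply Cmod_triangle|auto]. }
    assert (H2 : (Cmod (INR n * h ^ 2 * (z ^ n / z)) <= INR n * Cmod h ^ 2 * (rho ^ n / rho))%R).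
    { rewrite !Cmod_mult, Cmod_INR, Cmod_pow. destruct n as [|n].
      - simpl. rewrite !Rmult_0_l; lra.
      - apply Rmult_le_compat_l.
        { apply Rmult_le_pos; [apply pos_INR|apply pow2_ge_0]. }
        replace (z ^ S n / z) with (z ^ n) by (simpl; now field).
        rewrite Cmod_pow. replace (rho ^ S n / rho)%R with (rho ^ n)%R by (simpl; field; lra).
        apply pow_incr; lra. }
    eapply Rle_trans; [apply Cmod_triangle|].
    eapply Rle_trans; [apply Rplus_le_compat; [exact H1|exact H2]|].
    rewrite S_INR. replace (rho ^ S n / rho ^ 2)%R with (rho ^ n / rho)%R
      by (simpl; field; lra).
    replace (rho * (Cmod h ^ 2 * (INR n ^ 2 * (rho ^ n / rho ^ 2))))%R with
      (Cmod h ^ 2 * (rho ^ n / rho) * INR n ^ 2)%R by (field; lra).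
    assert (H3 : (0 <= Cmod h ^ 2 * (rho ^ n / rho))%R).
    { apply Rmult_le_pos; [apply pow2_ge_0|]. apply Rdiv_le_0_compat; auto. apply pow_le; lra. }
    assert (H4 := pos_INR n).
    replace (INR n * Cmod h ^ 2 * (rho ^ n / rho))%R with
      (Cmod h ^ 2 * (rho ^ n / rho) * INR n)%R by ring.
    rewrite <- Rmult_plus_distr_l.
    replace (Cmod h ^ 2 * ((INR n + 1) ^ 2 * (rho ^ n / rho)))%R with
      (Cmod h ^ 2 * (rho ^ n / rho) * (INR n + 1) ^ 2)%R by ring.
    apply Rmult_le_compat_l; auto. nra.
Qed.

(** The remainders of the monomials are summed. At the midpoint [rho] of [Cmod z] and [R0], the
    bound for the coefficients [B * w ^ 2] absorbs the factor [w ^ 2] of [pow_diff_quad], and the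
    range [Cmod h < rho - Cmod z] serves all indices at once. *)
Lemma psum_quad w B R0 (z : C) : good w B R0 -> z <> 0 -> (Cmod z < R0)%R ->
  quad_derive (psum w B) z (psum w (fun m n => B m n * INR (w m n)) z / z).
Proof.
  intros H Hz HzR.
  assert (H1 : good w (fun m n => B m n * INR (w m n)) R0) by now apply good_INR.
  assert (H2 : good w (fun m n => B m n * INR (w m n) * INR (w m n)) R0)
    by now apply (good_INR w (fun m n => B m n * INR (w m n))).
  assert (Hz0 := Cmod_ge_0 z).
  set (rho := ((Cmod z + R0) / 2)%R).
  assert (Hr : (0 < rho /\ Cmod z < rho /\ rho < R0)%R) by (unfold rho; lra).
  destruct (H2 rho ltac:(lra)) as [M [p [q [Hp [Hq HB]]]]].
  set (T := (/ (1 - p) * / (1 - q))%R).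
  assert (HT : (0 <= T)%R).
  { unfold T. apply Rmult_le_pos; apply Rlt_le, Rinv_0_lt_compat; lra. }
  assert (HM : (0 <= M)%R).
  { specialize (HB 0%nat 0%nat). simpl in HB. rewrite !Rmult_1_r in HB.
    eapply Rle_trans; [|exact HB]. apply Rmult_le_pos; [apply Cmod_ge_0|apply pow_le; lra]. }
  exists (M / rho ^ 2 * T)%R, (rho - Cmod z)%R. split; [lra|]. split.
  { apply Rmult_le_pos; auto. apply Rdiv_le_0_compat; auto. apply pow_lt; lra. }
  intros h Hh.
  assert (S0 := good_is_sum2 w B R0 z H HzR).
  assert (S1 := good_is_sum2 w _ R0 z H1 HzR).
  assert (S2 : is_sum2 (fun m n => B m n * (z + h) ^ w m n) (psum w B (z + h))).
  { apply good_is_sum2 with R0; auto. eapply Rle_lt_trans; [apply Cmod_triangle|lra]. }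
  assert (S3 := is_sum2_plus _ _ _ _ (is_sum2_plus _ _ _ _ S2 (is_sum2_scal (- (1)) _ _ S0))
    (is_sum2_scal (- (h / z)) _ _ S1)).
  replace (psum w B (z + h) - psum w B z - h * (psum w (fun m n => B m n * INR (w m n)) z / z))
    with (psum w B (z + h) + - (1) * psum w B z +
      - (h / z) * psum w (fun m n => B m n * INR (w m n)) z) by (unfold Cdiv; ring).
  destruct (is_sum2_geom_dominated
    (fun m n => B m n * (z + h) ^ w m n + - (1) * (B m n * z ^ w m n) +
      - (h / z) * (B m n * INR (w m n) * z ^ w m n))
    (Cmod h ^ 2 * (M / rho ^ 2))%R p q Hp Hq) as [l [Hl Hlb]].
  - intros m n.
    replace (B m n * (z + h) ^ w m n + - (1) * (B m n * z ^ w m n) +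
      - (h / z) * (B m n * INR (w m n) * z ^ w m n)) with
      (B m n * ((z + h) ^ w m n - z ^ w m n - h / z * (INR (w m n) * z ^ w m n))) by ring.
    rewrite Cmod_mult. specialize (HB m n). rewrite !Cmod_mult, !Cmod_INR in HB.
    eapply Rle_trans; [apply Rmult_le_compat_l; [apply Cmod_ge_0|]|].
    + apply pow_diff_quad with (rho := rho); [exact Hz|lra|lra].
    + apply Rle_trans with (Cmod h ^ 2 / rho ^ 2 *
        (Cmod (B m n) * INR (w m n) * INR (w m n) * rho ^ w m n))%R.
      * right. field. lra.
      * apply Rle_trans with (Cmod h ^ 2 / rho ^ 2 * (M * (p ^ m * q ^ n)))%R.
        -- apply Rmult_le_compat_l; auto. apply Rdiv_le_0_compat; [apply pow2_ge_0|].
           apply pow_lt; lra.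
        -- right; field; lra.
  - rewrite (is_sum2_unique _ _ _ S3 Hl). fold T in Hlb. eapply Rle_trans; [exact Hlb|].
    right; ring.
Qed.

Fixpoint falling (u : C) (k : nat) : C :=
  match k with
  | O => 1
  | S k' => falling u k' * (u - INR k')
  end.

Lemma good_falling w B R0 s r :
  good w B R0 -> good w (fun m n => B m n * falling (s + INR (w m n)) r) R0.
Proof.
  intros H; induction r as [|r IH]; simpl.
  - revert H. apply good_ext; intros; ring.
  - apply good_affine with (s := s - INR r) in IH.
    revert IH. apply good_ext; intros; ring.
Qed.

(** In the product rule [cpow L s z / z] is [cpow L (s - 1) z], so the derivative has the shape of
    the function itself with [s] lowered by one; this is what can be iterated. *)
Lemma cpow_psum_quad w B R0 s L z : good w B R0 -> is_log_branch L z -> (Cmod z < R0)%R ->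
  quad_derive (fun v => cpow L s v * psum w B v) z
    (cpow L (s - 1) z * psum w (fun m n => B m n * (s + INR (w m n))) z).
Proof.
  intros H HL Hz. assert (Hz0 := log_branch_neq_0 _ _ HL).
  assert (He : Cexp (L z) = z) by (now apply locally_singleton in HL).
  assert (H1 := quad_derive_mult _ _ _ _ _ (cpow_quad L s z HL) (psum_quad w B R0 z H Hz0 Hz)).
  assert (Hpow : cpow L s z = cpow L (s - 1) z * z).
  { rewrite <- He at 3. unfold cpow. rewrite <- Cexp_plus. f_equal; ring. }
  assert (HS : psum w (fun m n => B m n * (s + INR (w m n))) z =
    s * psum w B z + psum w (fun m n => B m n * INR (w m n)) z).
  { apply Sum2_is.
    assert (H2 := good_INR w B R0 H).
    assert (H3 := is_sum2_plus _ _ _ _ (is_sum2_scal s _ _ (good_is_sum2 w B R0 z H Hz))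
      (good_is_sum2 w _ R0 z H2 Hz)).
    replace (fun m n => B m n * (s + INR (w m n)) * z ^ w m n) with
      (fun m n => s * (B m n * z ^ w m n) + B m n * INR (w m n) * z ^ w m n); auto.
    extensionality m; extensionality n; ring. }
  rewrite HS.
  replace (cpow L (s - 1) z * (s * psum w B z + psum w (fun m n => B m n * INR (w m n)) z))
    with (s * cpow L (s - 1) z * psum w B z +
      cpow L s z * (psum w (fun m n => B m n * INR (w m n)) z / z)); auto.
  rewrite Hpow. now field.
Qed.

Lemma cpow_psum_C_derive_n w B R0 s L r z :
  good w B R0 -> is_log_branch L z -> (Cmod z < R0)%R ->
  is_C_derive_n (fun v => cpow L s v * psum w B v) r z
    (cpow L (s - INR r) z * psum w (fun m n => B m n * falling (s + INR (w m n)) r) z).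
Proof.
  intros H; revert z; induction r as [|r IH]; intros z HL Hz.
  - simpl. f_equal; [f_equal; ring|]. unfold psum. apply Sum2_ext; intros; ring.
  - exists (fun v => cpow L (s - INR r) v *
      psum w (fun m n => B m n * falling (s + INR (w m n)) r) v). split.
    (* The hypotheses on [z] are open conditions, so the induction hypothesis is available at every
       nearby point. *)
    + apply locally_locally in HL.
      assert (HR : locally z (fun v => Cmod v < R0)%R).
      { apply locally_C_Cmod. exists (R0 - Cmod z)%R. split; [lra|]. intros v Hv.
        replace v with (z + (v - z)) by ring.
        eapply Rle_lt_trans; [apply Cmod_triangle|lra]. }
      generalize (filter_and _ _ HL HR). apply filter_imp. intros v [Hv1 Hv2].
      now apply IH.
    + apply quad_derive_is_derive. rewrite S_INR, RtoC_plus.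
      replace (s - (INR r + 1)) with (s - INR r - 1) by ring.
      replace (fun m n => B m n * falling (s + INR (w m n)) (S r)) with
        (fun m n => B m n * falling (s + INR (w m n)) r * (s - INR r + INR (w m n))).
      * apply cpow_psum_quad with R0; auto. now apply good_falling.
      * extensionality m; extensionality n; simpl; ring.
Qed.

Lemma is_C_derive_n_locally_0 (f : C -> C) n (z : C) : locally z (fun v : C => f v = 0) ->
  is_C_derive_n f n z 0.
Proof.
  revert z; induction n as [|n IH]; intros z H.
  - exact (locally_singleton z _ H).
  - exists (fun _ => 0). split.
    + apply locally_locally in H. revert H. apply filter_imp. intros v Hv. now apply IH.
    + apply quad_derive_is_derive. exists 0%R, 1%R. repeat split; try lra.
      intros h _. replace (0 - 0 - h * 0) with (RtoC 0) by ring. rewrite Cmod_0; lra.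
Qed.

(** * The discrete Appell function *)

Definition nonpole (c : C) : Prop := forall j : nat, Re c <> (- INR j)%R.

(** This means that [u] is 0 or a negative integer. *)
Definition terminating (u : C) : Prop := exists k, poch u k = 0.

Lemma poch_add u m n : poch u (m + n) = poch u m * poch (u + INR m) n.
Proof.
  induction n as [|n IH]; [rewrite Nat.add_0_r; simpl; ring|].
  rewrite Nat.add_succ_r. simpl. rewrite IH, plus_INR, RtoC_plus. ring.
Qed.

Lemma poch_exchange u m r :
  poch u m * poch (u + INR m) r = poch u r * poch (u + INR r) m.
Proof. rewrite <- !poch_add. f_equal; lia. Qed.

Lemma poch_eq_0_le u k n : poch u k = 0 -> (k <= n)%nat -> poch u n = 0.
Proof.
  intros H Hn. replace n with (k + (n - k))%nat by lia. rewrite poch_add, H. ring.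
Qed.

Lemma poch_neq_0 c n : nonpole c -> poch c n <> 0.
Proof.
  intros Hc; induction n as [|n IH]; simpl; [apply C1_nz|].
  apply Cmult_neq_0; auto. intros E. apply (Hc n).
  apply (f_equal Re) in E. rewrite re_plus in E. simpl in E. lra.
Qed.

Lemma terminating_shift u r : terminating (u + INR r) -> terminating u.
Proof.
  intros [k Hk]; exists (r + k)%nat. rewrite poch_add, Hk; ring.
Qed.

(** Both are the product of [u, ..., u + r - 1], built from opposite ends; hence the first factor of
    [poch] is split off rather than the last. This is the source of the exponents [b1 + r - 1] and
    [a + r - 1]. *)
Lemma falling_poch u r : falling (u + INR r - 1) r = poch u r.
Proof.
  revert u; induction r as [|r IH]; intros u; [easy|].
  assert (E := poch_add u 1 r). simpl Nat.add in E. rewrite E, <- IH, S_INR, RtoC_plus.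
  simpl.
  replace (u + (INR r + 1) - 1) with (u + 1 + INR r - 1) by ring. ring.
Qed.

Lemma falling_pred c r : falling (c - 1) r = (-(1)) ^ r * poch (1 - c) r.
Proof.
  induction r as [|r IH]; simpl; [ring|rewrite IH; ring].
Qed.

(** * Growth of the factors of a term, and divergence *)

Definition gamma_ratio (a c : C) (n : nat) : C := poch a n / poch c n.

(** All of a term that depends on one index only, apart from the power of the variable; the indices
    interact only through [gamma_ratio] at [m + n]. *)
Definition weight (b t : C) (k m : nat) : C :=
  poch b m * (-(1)) ^ (m * k) * poch (- t) (m * k) / INR (fact m).

Lemma INR_fact_C_neq_0 n : RtoC (INR (fact n)) <> 0.
Proof. intros E. apply RtoC_inj in E. now apply (INR_fact_neq_0 n). Qed.

Lemma discreteF1_termE a b1 b2 c t1 t2 k1 k2 x y m n : nonpole c ->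
  discreteF1_term a b1 b2 c t1 t2 k1 k2 x y m n =
  gamma_ratio a c (m + n) * weight b1 t1 k1 m * weight b2 t2 k2 n * x ^ m * y ^ n.
Proof.
  intros Hc. unfold discreteF1_term, gamma_ratio, weight. field.
  repeat split; auto using INR_fact_C_neq_0, poch_neq_0.
Qed.

Lemma discreteF1_swap a b1 b2 c t1 t2 k1 k2 x y :
  discreteF1 a b1 b2 c t1 t2 k1 k2 x y = discreteF1 a b2 b1 c t2 t1 k2 k1 y x.
Proof.
  unfold discreteF1. rewrite <- Sum2_swap. apply Sum2_ext. intros m n.
  unfold discreteF1_term. rewrite (Nat.add_comm n m).
  replace (poch c (m + n) * INR (fact n) * INR (fact m)) with
    (poch c (m + n) * INR (fact m) * INR (fact n)) by ring.
  unfold Cdiv; ring.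
Qed.

Lemma Cinv_neq_0 (z : C) : z <> 0 -> / z <> 0.
Proof.
  intros Hz E. apply C1_nz. rewrite <- (Cinv_r z Hz), E. ring.
Qed.

Lemma gamma_ratio_S a c n : nonpole c ->
  gamma_ratio a c (S n) * (c + INR n) = gamma_ratio a c n * (a + INR n).
Proof.
  intros Hc. unfold gamma_ratio. assert (H := poch_neq_0 c (S n) Hc). simpl in *.
  field. split; intros E; apply H; rewrite E; ring.
Qed.

(** The last factor is a polynomial of degree [k] in [m], so, unless the weight vanishes eventually,
    its quotients tend to 1 for [k = 0] and grow like [m ^ k] otherwise. *)
Lemma weight_S b t k m :
  weight b t k (S m) * (1 + INR m) =
  weight b t k m * (b + INR m) * ((-(1)) ^ k * poch (- t + INR (m * k)) k).
Proof.
  unfold weight. replace (S m * k)%nat with (m * k + k)%nat by lia.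
  rewrite poch_add, Cpow_add_r. replace (fact (S m)) with ((m + 1) * fact m)%nat by (simpl; lia).
  rewrite (mult_INR (m + 1)), (plus_INR m 1), RtoC_mult, RtoC_plus. simpl poch.
  assert (H := INR_fact_C_neq_0 m). simpl INR.
  assert (H2 : RtoC (INR m) + 1 <> 0).
  { intros E. apply (f_equal Re) in E. simpl in E. pose proof (pos_INR m). lra. }
  field. auto.
Qed.

Lemma shift_eventually_neq_0 (v : C) : exists N, forall n, (N <= n)%nat -> (0 < Cmod (v + INR n))%R.
Proof.
  destruct (INR_eventually_ge (Cmod v + 1)) as [N HN]. exists N; intros n Hn.
  specialize (HN n Hn). pose proof (Cmod_shift_ge v n). lra.
Qed.

(* The quotients of [u] tend to 1. *)
Lemma subexp_hypergeometric u u0 v :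
  (forall n, u (S n) * (v + INR n) = u n * (u0 + INR n)) -> subexp u.
Proof.
  intros H. apply subexp_ratio. intros q Hq.
  destruct (shift_ratio u0 v q Hq) as [N HN].
  destruct (shift_eventually_neq_0 v) as [N' HN']. exists (N + N')%nat. intros n Hn.
  specialize (HN n ltac:(lia)). specialize (HN' n ltac:(lia)).
  apply Rmult_le_reg_r with (Cmod (v + INR n)); auto.
  rewrite <- Cmod_mult, H, Cmod_mult.
  pose proof (Cmod_ge_0 (u n)). nra.
Qed.

Lemma subexp_gamma_ratio a c : nonpole c -> subexp (gamma_ratio a c).
Proof.
  intros Hc. apply subexp_hypergeometric with a c. intros n. now apply gamma_ratio_S.
Qed.

(* The cases in which [weight b t k] has at most subexponential growth; in all others it
   grows faster than every exponential. *)
Definition tame (b t : C) (k : nat) : Prop :=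
  k = 0%nat \/ terminating b \/ terminating (- t).

(** For [k = 0] the quotients are [(b + n) / (1 + n)]; otherwise one of the Pochhammer symbols
    vanishes from some index on. *)
Lemma subexp_weight b t k : tame b t k -> subexp (weight b t k).
Proof.
  intros H. destruct (Nat.eq_dec k 0) as [->|Hk].
  - apply subexp_hypergeometric with b (RtoC 1). intros n. rewrite weight_S. simpl. ring.
  - destruct H as [H|[[K HK]|[K HK]]]; [easy| |].
    + apply subexp_eventually_0 with K. intros n Hn. unfold weight.
      rewrite (poch_eq_0_le b K n HK Hn). unfold Cdiv; ring.
    + apply subexp_eventually_0 with K. intros n Hn. unfold weight.
      rewrite (poch_eq_0_le (- t) K (n * k) HK) by nia. unfold Cdiv; ring.
Qed.

Lemma poch_Cmod_ge (v : C) (Y : R) k : (1 <= Y)%R ->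
  (forall j, (Y <= Cmod (v + INR j))%R) -> (k <> 0)%nat -> (Y <= Cmod (poch v k))%R.
Proof.
  intros HY H Hk. destruct k as [|k]; [easy|]. clear Hk. induction k as [|k IH].
  - specialize (H 0%nat). simpl poch. rewrite Cmult_1_l. exact H.
  - change (poch v (S (S k))) with (poch v (S k) * (v + INR (S k))).
    rewrite Cmod_mult. specialize (H (S k)). nra.
Qed.

(** No term vanishes, and the quotients eventually have modulus at least 2. *)
Lemma wild_weight_unbounded a c b t k x (M : R) :
  nonpole c -> ~ terminating a -> ~ tame b t k -> x <> RtoC 0 ->
  exists m, (M < Cmod (gamma_ratio a c m * weight b t k m * x ^ m))%R.
Proof.
  intros Hc Ha Hw Hx. unfold tame in Hw.
  assert (Hk : (k <> 0)%nat) by tauto.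
  set (u := fun m => gamma_ratio a c m * weight b t k m * x ^ m).
  assert (Hx0 : (0 < Cmod x)%R) by now apply Cmod_gt_0.
  (* The 8 is [2 * 2 * 2]: the quotients [(a + m) / (c + m)] and [(b + m) / (1 + m)] may each cost a
     factor 2, and a factor 2 must remain. *)
  set (Y := Rmax 1 (8 / Cmod x)).
  assert (HY : (1 <= Y)%R) by apply Rmax_l.
  assert (HYx : (8 <= Y * Cmod x)%R).
  { apply Rle_trans with (8 / Cmod x * Cmod x)%R; [right; field; lra|].
    apply Rmult_le_compat_r; [lra|apply Rmax_r]. }
  assert (Hnz : forall m, (0 < Cmod (u m))%R).
  { intros m. apply Cmod_gt_0. unfold u.
    repeat apply Cmult_neq_0.
    - intros E; apply Ha; now exists m.
    - apply Cinv_neq_0, poch_neq_0, Hc.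
    - intros E; apply Hw; right; left; now exists m.
    - apply Cpow_nz. intros E. apply (f_equal Re) in E; simpl in E; lra.
    - intros E; apply Hw; right; right; now exists (m * k)%nat.
    - apply Cinv_neq_0, INR_fact_C_neq_0.
    - now apply Cpow_nz. }
  destruct (shift_ratio c a 2 ltac:(lra)) as [N1 H1].
  destruct (shift_ratio 1 b 2 ltac:(lra)) as [N2 H2].
  destruct (INR_eventually_ge (Cmod t + Y)) as [N3 H3].
  destruct (shift_eventually_neq_0 c) as [N4 H4].
  set (N := (N1 + N2 + N3 + N4)%nat).
  assert (Hstep : forall m, (N <= m)%nat -> (2 * Cmod (u m) <= Cmod (u (S m)))%R).
  { intros m Hm. specialize (H1 m ltac:(lia)). specialize (H2 m ltac:(lia)).
    specialize (H3 m ltac:(lia)). specialize (H4 m ltac:(lia)).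
    set (p := poch (- t + INR (m * k)) k).
    assert (Hp : (Y <= Cmod p)%R).
    { apply poch_Cmod_ge; auto. intros j.
      replace (- t + INR (m * k) + INR j) with (- t + INR (m * k + j))
        by (rewrite plus_INR, RtoC_plus; ring).
      pose proof (Cmod_shift_ge (- t) (m * k + j)) as H5. rewrite Cmod_opp in H5.
      assert (H6 : (INR m <= INR (m * k + j))%R) by (apply le_INR; nia). lra. }
    assert (E : u (S m) * ((c + INR m) * (1 + INR m)) =
      u m * ((a + INR m) * (b + INR m)) * ((-(1)) ^ k * p * x)).
    { unfold u. simpl Cpow.
      replace (gamma_ratio a c (S m) * weight b t k (S m) * (x * x ^ m) *
        ((c + INR m) * (1 + INR m))) with
        ((gamma_ratio a c (S m) * (c + INR m)) * (weight b t k (S m) * (1 + INR m)) * x ^ m * x)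
        by ring.
      rewrite gamma_ratio_S, weight_S by auto. fold p. ring. }
    apply (f_equal Cmod) in E. rewrite !Cmod_mult, Cmod_pow, Cmod_opp, Cmod_1, pow1 in E.
    set (A := Cmod (a + INR m)) in *. set (B := Cmod (b + INR m)) in *.
    set (D := Cmod (c + INR m)) in *.
    assert (H7 : (0 < Cmod (1 + INR m))%R).
    { apply Cmod_gt_0. intros E'. apply (f_equal Re) in E'. simpl in E'.
      pose proof (pos_INR m). lra. }
    set (F := Cmod (1 + INR m)) in *.
    apply Rmult_le_reg_r with (D * F)%R; [now apply Rmult_lt_0_compat|].
    rewrite E. specialize (Hnz m).
    assert (H8 : (D * F <= 2 * A * (2 * B))%R) by (apply Rmult_le_compat; lra).
    assert (H9 : (8 <= 1 * Cmod p * Cmod x)%R) by nra.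
    assert (H10 : (0 <= A * B)%R) by (apply Rmult_le_pos; apply Cmod_ge_0).
    apply Rle_trans with (Cmod (u m) * (A * B) * 8)%R.
    - nra.
    - apply Rmult_le_compat_l; [|exact H9]. apply Rmult_le_pos; lra. }
  (* A linear lower bound, weaker than the doubling, already passes every [M]. *)
  assert (Hgrow : forall j, (INR j * Cmod (u N) <= Cmod (u (N + j)%nat))%R).
  { induction j as [|j IH]; [rewrite Nat.add_0_r; simpl; specialize (Hnz N); lra|].
    assert (Hj : (Cmod (u N) <= Cmod (u (N + j)%nat))%R).
    { clear IH. induction j as [|j IHj]; [rewrite Nat.add_0_r; lra|].
      rewrite Nat.add_succ_r. specialize (Hstep (N + j)%nat ltac:(lia)).
      specialize (Hnz (N + j)%nat). lra. }
    rewrite Nat.add_succ_r, S_INR. specialize (Hstep (N + j)%nat ltac:(lia)). lra. }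
  destruct (INR_eventually_ge ((M + 1) / Cmod (u N))) as [j Hj].
  exists (N + j)%nat. fold (u (N + j)%nat). specialize (Hj j ltac:(lia)).
  specialize (Hgrow j). specialize (Hnz N).
  assert (M + 1 <= INR j * Cmod (u N))%R.
  { apply Rle_trans with ((M + 1) / Cmod (u N) * Cmod (u N))%R; [right; field; lra|].
    apply Rmult_le_compat_r; lra. }
  lra.
Qed.

Lemma weight_0 b t k : weight b t k 0 = 1.
Proof. unfold weight. simpl. field. Qed.

(** The terms with [n = 0] alone are unbounded; there the second weight and the power of [y] are
    1. *)
Lemma discreteF1_wild_l a b1 b2 c t1 t2 k1 k2 x y :
  nonpole c -> ~ terminating a -> ~ tame b1 t1 k1 -> x <> RtoC 0 ->
  discreteF1 a b1 b2 c t1 t2 k1 k2 x y = 0.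
Proof.
  intros Hc Ha Hw Hx. apply Sum2_diverges. intros [l Hl].
  destruct (is_sum2_terms_bounded _ _ Hl) as [M HM].
  destruct (wild_weight_unbounded a c b1 t1 k1 x M Hc Ha Hw Hx) as [m Hm].
  specialize (HM m 0%nat). rewrite discreteF1_termE, weight_0, Nat.add_0_r in HM by auto.
  simpl Cpow in HM. rewrite !Cmult_1_r in HM. lra.
Qed.

Lemma discreteF1_wild a b1 b2 c t1 t2 k1 k2 x y :
  nonpole c -> ~ terminating a ->
  (~ tame b1 t1 k1 /\ x <> RtoC 0) \/ (~ tame b2 t2 k2 /\ y <> RtoC 0) ->
  discreteF1 a b1 b2 c t1 t2 k1 k2 x y = 0.
Proof.
  intros Hc Ha [[H1 H2]|[H1 H2]]; [|rewrite discreteF1_swap]; now apply discreteF1_wild_l.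
Qed.

(** * Geometric domination in the convergent case *)

Definition truncate (K : nat) (u : nat -> C) (n : nat) : C :=
  if Nat.ltb n K then u n else 0.

Lemma subexp_truncate K u : subexp (truncate K u).
Proof.
  apply subexp_eventually_0 with K. intros n Hn. unfold truncate.
  now destruct (Nat.ltb_spec n K); [lia|].
Qed.

Lemma product_geom_bound g u v (al be : R) :
  subexp g -> subexp u -> subexp v -> (0 <= al < 1)%R -> (0 <= be < 1)%R ->
  exists M p q : R, (0 <= p < 1)%R /\ (0 <= q < 1)%R /\ forall m n,
    (Cmod (g (m + n)%nat * u m * v n) * (al ^ m * be ^ n) <= M * (p ^ m * q ^ n))%R.
Proof.
  intros Hg Hu Hv Ha Hb.
  set (s := Rmax al be).
  assert (Hs : (0 <= s < 1 /\ al <= s /\ be <= s)%R).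
  { unfold s. pose proof (Rmax_l al be). pose proof (Rmax_r al be).
    repeat split; try lra. apply Rmax_lub_lt; lra. }
  (* Each index receives one [q] from [g] and one from its own factor; since [s = 1 - 4 * e], the
     product [(1 + e) ^ 2 * s] stays below 1. *)
  set (e := ((1 - s) / 4)%R). set (q := (1 + e)%R).
  assert (He : (0 < e <= 1 / 4)%R) by (unfold e; lra).
  assert (Hq : (1 < q)%R) by (unfold q; lra).
  assert (Hqs : (0 <= q * q * s < 1)%R).
  { unfold q. replace s with (1 - 4 * e)%R by (unfold e; field).
    assert (0 <= 1 - 4 * e)%R by lra. split; [|nra].
    apply Rmult_le_pos; auto. nra. }
  destruct (Hg q Hq) as [Mg [HMg Bg]]. destruct (Hu q Hq) as [Mu [HMu Bu]].
  destruct (Hv q Hq) as [Mv [HMv Bv]].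
  exists (Mg * Mu * Mv)%R, (q * q * al)%R, (q * q * be)%R.
  assert (Hqq : (1 < q * q)%R) by nra.
  split; [split; [apply Rmult_le_pos; lra|nra]|].
  split; [split; [apply Rmult_le_pos; lra|nra]|].
  intros m n. rewrite !Cmod_mult.
  apply Rle_trans with ((Mg * q ^ (m + n)) * (Mu * q ^ m) * (Mv * q ^ n) * (al ^ m * be ^ n))%R.
  - apply Rmult_le_compat_r; [apply Rmult_le_pos; apply pow_le; lra|].
    repeat apply Rmult_le_compat; auto; try apply Rmult_le_pos; auto using Cmod_ge_0.
  - right. rewrite !Rpow_mult_distr, pow_add. ring.
Qed.

(** A wild weight may be truncated where the product vanishes anyway: when [a] terminates,
    [gamma_ratio] is 0 as soon as one index reaches [K]; when [be = 0], the power [be ^ n] is 0 past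
    [n = 0]. Only subexponential factors remain. *)
Lemma tame_geom_bound a b1 b2 c t1 t2 k1 k2 (al be : R) :
  nonpole c ->
  terminating a \/ (tame b1 t1 k1 /\ (tame b2 t2 k2 \/ be = 0%R)) ->
  (0 <= al < 1)%R -> (0 <= be < 1)%R ->
  exists M p q : R, (0 <= p < 1)%R /\ (0 <= q < 1)%R /\ forall m n,
    (Cmod (gamma_ratio a c (m + n) * weight b1 t1 k1 m * weight b2 t2 k2 n)
      * (al ^ m * be ^ n) <= M * (p ^ m * q ^ n))%R.
Proof.
  intros Hc H Ha Hb.
  assert (HW : exists u v, subexp u /\ subexp v /\ forall m n,
    (Cmod (gamma_ratio a c (m + n) * weight b1 t1 k1 m * weight b2 t2 k2 n)
      * (al ^ m * be ^ n))%R =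
    (Cmod (gamma_ratio a c (m + n) * u m * v n) * (al ^ m * be ^ n))%R).
  { destruct H as [[K HK]|[H1 [H2|H2]]].
    - exists (truncate K (weight b1 t1 k1)), (truncate K (weight b2 t2 k2)).
      split; [apply subexp_truncate|]. split; [apply subexp_truncate|].
      intros m n. do 2 f_equal. unfold truncate.
      assert (H0 : (K <= m + n)%nat -> gamma_ratio a c (m + n) = 0).
      { intros Hmn. unfold gamma_ratio. rewrite (poch_eq_0_le a K _ HK Hmn).
        unfold Cdiv; ring. }
      destruct (Nat.ltb_spec m K); destruct (Nat.ltb_spec n K); auto;
        rewrite H0 by lia; ring.
    - exists (weight b1 t1 k1), (weight b2 t2 k2). auto using subexp_weight.
    - exists (weight b1 t1 k1), (truncate 1 (weight b2 t2 k2)).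
      split; [now apply subexp_weight|]. split; [apply subexp_truncate|].
      intros m [|n]; [easy|]. rewrite H2. simpl. ring. }
  destruct HW as [u [v [Hu [Hv HW]]]].
  destruct (product_geom_bound _ u v al be (subexp_gamma_ratio a c Hc) Hu Hv Ha Hb)
    as [M [p [q [Hp [Hq HM]]]]].
  exists M, p, q. repeat (split; [assumption|]). intros m n. rewrite HW. apply HM.
Qed.

(** Here [y] is constant under the differentiation: it is the second variable when the exponent is
    [m], and the ratio of the second variable to the first when the exponent is [m + n]. *)
Definition coef (a b1 b2 c t1 t2 : C) (k1 k2 : nat) (y : C) (m n : nat) : C :=
  gamma_ratio a c (m + n) * weight b1 t1 k1 m * weight b2 t2 k2 n * y ^ n.

Lemma discreteF1_psum_fst a b1 b2 c t1 t2 k1 k2 z y : nonpole c ->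
  discreteF1 a b1 b2 c t1 t2 k1 k2 z y =
  psum (fun m _ => m) (coef a b1 b2 c t1 t2 k1 k2 y) z.
Proof.
  intros Hc. apply Sum2_ext. intros m n. rewrite discreteF1_termE by auto.
  unfold coef. ring.
Qed.

Lemma discreteF1_psum_add a b1 b2 c t1 t2 k1 k2 z y : nonpole c ->
  discreteF1 a b1 b2 c t1 t2 k1 k2 z (z * y) =
  psum Nat.add (coef a b1 b2 c t1 t2 k1 k2 y) z.
Proof.
  intros Hc. apply Sum2_ext. intros m n. rewrite discreteF1_termE by auto.
  unfold coef. rewrite Cpow_mult_l, Cpow_add_r. ring.
Qed.

Lemma good_coef_fst a b1 b2 c t1 t2 k1 k2 y : nonpole c ->
  terminating a \/ (tame b1 t1 k1 /\ (tame b2 t2 k2 \/ y = RtoC 0)) -> (Cmod y < 1)%R ->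
  good (fun m _ => m) (coef a b1 b2 c t1 t2 k1 k2 y) 1.
Proof.
  intros Hc H Hy rho Hrho.
  destruct (tame_geom_bound a b1 b2 c t1 t2 k1 k2 rho (Cmod y) Hc) as [M [p [q [Hp [Hq HM]]]]];
    auto using Cmod_ge_0.
  - destruct H as [H|[H [H'|H']]]; auto. right; split; auto. right. rewrite H'. apply Cmod_0.
  - exists M, p, q. repeat (split; [assumption|]). intros m n.
    unfold coef. rewrite Cmod_mult, Cmod_pow.
    eapply Rle_trans; [|apply HM]. right; ring.
Qed.

Lemma good_coef_add a b1 b2 c t1 t2 k1 k2 y R0 : nonpole c ->
  terminating a \/ (tame b1 t1 k1 /\ (tame b2 t2 k2 \/ y = RtoC 0)) ->
  (R0 <= 1)%R -> (R0 * Cmod y <= 1)%R ->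
  good Nat.add (coef a b1 b2 c t1 t2 k1 k2 y) R0.
Proof.
  intros Hc H H1 H2 rho Hrho. assert (Hy := Cmod_ge_0 y).
  destruct (tame_geom_bound a b1 b2 c t1 t2 k1 k2 rho (rho * Cmod y) Hc)
    as [M [p [q [Hp [Hq HM]]]]].
  - destruct H as [H|[H [H'|H']]]; auto. right; split; auto. right.
    rewrite H', Cmod_0; ring.
  - lra.
  - split; [apply Rmult_le_pos; lra|].
    (* From [rho < R0] a strict inequality follows only after multiplication by a positive
       [Cmod y]. *)
    destruct (Req_dec (Cmod y) 0) as [->|H0]; [lra|nra].
  - exists M, p, q. repeat (split; [assumption|]). intros m n.
    unfold coef. rewrite Cmod_mult, Cmod_pow.
    eapply Rle_trans; [|apply HM]. right. rewrite Rpow_mult_distr, pow_add. ring.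
Qed.

(* Either the series converges absolutely near [x], and is differentiated termwise, or it
   diverges at every point [z <> 0] and both sides vanish. *)
Lemma cpow_discreteF1_C_derive_n a b1 b2 c t1 t2 k1 k2 (w : nat -> nat -> nat)
    (Y : C -> C) (y s : C) (r : nat) (L : C -> C) (x : C) (R0 : R) (k F : C) :
  nonpole c -> is_log_branch L x -> (Cmod x < R0)%R ->
  (forall z, discreteF1 a b1 b2 c t1 t2 k1 k2 z (Y z) =
    psum w (coef a b1 b2 c t1 t2 k1 k2 y) z) ->
  (terminating a \/ (tame b1 t1 k1 /\ (tame b2 t2 k2 \/ y = 0)) ->
    good w (coef a b1 b2 c t1 t2 k1 k2 y) R0) ->
  (forall z, y <> 0 -> z <> RtoC 0 -> Y z <> 0) ->
  k * F = psum w (fun m n => coef a b1 b2 c t1 t2 k1 k2 y m n *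
    falling (s + INR (w m n)) r) x ->
  (~ terminating a -> ~ tame b1 t1 k1 \/ (~ tame b2 t2 k2 /\ Y x <> 0) -> F = 0) ->
  is_C_derive_n (fun z => cpow L s z * discreteF1 a b1 b2 c t1 t2 k1 k2 z (Y z)) r x
    (cpow L (s - INR r) x * (k * F)).
Proof.
  intros Hc HL Hx HF Hgood HY Hk HF0.
  destruct (classic (terminating a \/ (tame b1 t1 k1 /\ (tame b2 t2 k2 \/ y = 0)))) as [H|H].
  - rewrite Hk.
    replace (fun z => cpow L s z * discreteF1 a b1 b2 c t1 t2 k1 k2 z (Y z)) with
      (fun z => cpow L s z * psum w (coef a b1 b2 c t1 t2 k1 k2 y) z)
      by (extensionality z; now rewrite HF).
    apply cpow_psum_C_derive_n with R0; auto.
  - assert (Ha : ~ terminating a) by tauto.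
    assert (H' : ~ tame b1 t1 k1 \/ (~ tame b2 t2 k2 /\ y <> 0)).
    { destruct (classic (tame b1 t1 k1)); tauto. }
    rewrite HF0; auto.
    2:{ destruct H' as [H'|[H1 H2]]; auto. right; split; auto. apply HY; auto.
        now apply log_branch_neq_0 with L. }
    rewrite !Cmult_0_r. apply is_C_derive_n_locally_0.
    (* Near [x] the function [L] remains a branch of the logarithm, so no nearby point is 0 and
       divergence holds throughout. *)
    apply locally_locally in HL. revert HL. apply filter_imp. intros z Hz.
    apply log_branch_neq_0 in Hz. rewrite discreteF1_wild; auto; [ring|].
    destruct H' as [H'|[H1 H2]]; auto.
Qed.

(** [R0] is the inverse of the maximum of 1 and [Cmod y], the radius of the disc of all [z] for
    which [z] and [z * y] both have modulus below 1. *)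
Lemma common_radius (x y : C) : (Cmod x < 1)%R -> (Cmod (x * y) < 1)%R ->
  exists R0 : R, (Cmod x < R0 /\ R0 <= 1 /\ R0 * Cmod y <= 1)%R.
Proof.
  intros Hx Hxy. rewrite Cmod_mult in Hxy.
  destruct (Rle_lt_dec (Cmod y) 1) as [H|H].
  - exists 1%R. lra.
  - exists (/ Cmod y)%R. split; [|split].
    + apply Rmult_lt_reg_r with (Cmod y); [lra|]. rewrite Rinv_l; lra.
    + rewrite <- Rinv_1. apply Rinv_le_contravar; lra.
    + rewrite Rinv_l; lra.
Qed.

(** * Parameter shifts and the six formulas *)

Lemma tame_shift b t k r : tame (b + INR r) t k -> tame b t k.
Proof.
  unfold tame. intros [H|[H|H]]; auto. right; left. now apply terminating_shift in H.
Qed.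

(** The exponent [b + r - 1] makes the falling factorial equal to [(b + m)_r], and exchanging [m]
    and [r] moves the shift into [b]. *)
Lemma weight_shift b t k m r :
  weight b t k m * falling (b + INR r - 1 + INR m) r = poch b r * weight (b + INR r) t k m.
Proof.
  replace (b + INR r - 1 + INR m) with (b + INR m + INR r - 1) by ring.
  rewrite falling_poch. unfold weight, Cdiv.
  transitivity (poch b m * poch (b + INR m) r *
    ((-(1)) ^ (m * k) * poch (- t) (m * k) * / INR (fact m))); [ring|].
  rewrite poch_exchange. ring.
Qed.

Lemma gamma_ratio_shift_num a c n r :
  gamma_ratio a c n * falling (a + INR r - 1 + INR n) r =
  poch a r * gamma_ratio (a + INR r) c n.
Proof.
  replace (a + INR r - 1 + INR n) with (a + INR n + INR r - 1) by ring.
  rewrite falling_poch. unfold gamma_ratio, Cdiv.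
  transitivity (poch a n * poch (a + INR n) r * / poch c n); [ring|].
  rewrite poch_exchange. ring.
Qed.

(** With [d = c - r] the falling factorials at [c - 1 + n] and [c - 1] are [(d + n)_r] and [(d)_r],
    and [(d)_n (d + n)_r = (d)_r (c)_n] trades the denominator [(c)_n] for [(d)_n]. *)
Lemma gamma_ratio_shift_den a c n r : nonpole c -> nonpole (c - INR r) ->
  gamma_ratio a c n * falling (c - 1 + INR n) r =
  (-(1)) ^ r * poch (1 - c) r * gamma_ratio a (c - INR r) n.
Proof.
  intros Hc Hcr. rewrite <- falling_pred.
  set (d := c - INR r) in *.
  assert (Ec : c = d + INR r) by (unfold d; ring).
  replace (c - 1 + INR n) with (d + INR n + INR r - 1) by (rewrite Ec; ring).
  replace (c - 1) with (d + INR r - 1) by (rewrite Ec; ring).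
  rewrite !falling_poch. unfold gamma_ratio.
  assert (H1 := poch_neq_0 c n Hc). assert (H2 := poch_neq_0 d n Hcr).
  assert (H3 := poch_exchange d n r). rewrite <- Ec in H3.
  replace (poch a n / poch c n * poch (d + INR n) r) with
    (poch a n * (poch d n * poch (d + INR n) r) / (poch c n * poch d n)) by (field; auto).
  rewrite H3. field; auto.
Qed.

Lemma discreteF1_derive_b1 a b1 b2 c t1 t2 k1 k2 r x y L :
  nonpole c -> (Cmod x < 1)%R -> (Cmod y < 1)%R -> is_log_branch L x ->
  is_C_derive_n
    (fun z => cpow L (b1 + INR r - 1) z * discreteF1 a b1 b2 c t1 t2 k1 k2 z y)
    r x
    (cpow L (b1 - 1) x * poch b1 r * discreteF1 a (b1 + INR r) b2 c t1 t2 k1 k2 x y).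
Proof.
  intros Hc Hx Hy HL. rewrite <- Cmult_assoc.
  replace (b1 - 1) with (b1 + INR r - 1 - INR r) by ring.
  apply (cpow_discreteF1_C_derive_n a b1 b2 c t1 t2 k1 k2 (fun m _ => m) (fun _ => y) y)
    with (R0 := 1%R); auto.
  - intros z. now apply discreteF1_psum_fst.
  - intros H. now apply good_coef_fst.
  (* The prefactor is moved inside the sum without knowing whether the raised series converges; when
     [(b1)_r = 0] it may diverge. *)
  - unfold discreteF1. rewrite <- Sum2_scal. apply Sum2_ext. intros m n.
    rewrite discreteF1_termE by auto. unfold coef.
    transitivity (poch b1 r * weight (b1 + INR r) t1 k1 m *
      (gamma_ratio a c (m + n) * weight b2 t2 k2 n * x ^ m * y ^ n)); [ring|].
    rewrite <- weight_shift. ring.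
  - intros Ha H. apply discreteF1_wild; auto.
    destruct H as [H|H]; auto. left; split.
    + intros H'. now apply H, tame_shift with r.
    + now apply log_branch_neq_0 with L.
Qed.

Lemma discreteF1_derive_a a b1 b2 c t1 t2 k1 k2 r x y L :
  nonpole c -> (Cmod x < 1)%R -> (Cmod (x * y) < 1)%R -> is_log_branch L x ->
  is_C_derive_n
    (fun z => cpow L (a + INR r - 1) z * discreteF1 a b1 b2 c t1 t2 k1 k2 z (z * y))
    r x
    (cpow L (a - 1) x * poch a r * discreteF1 (a + INR r) b1 b2 c t1 t2 k1 k2 x (x * y)).
Proof.
  intros Hc Hx Hxy HL. rewrite <- Cmult_assoc.
  replace (a - 1) with (a + INR r - 1 - INR r) by ring.
  destruct (common_radius x y Hx Hxy) as [R0 [H0 [H1 H2]]].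
  apply (cpow_discreteF1_C_derive_n a b1 b2 c t1 t2 k1 k2 Nat.add (fun z => z * y) y)
    with (R0 := R0); auto.
  - intros z. now apply discreteF1_psum_add.
  - intros H. now apply good_coef_add.
  - intros z Hy Hz. now apply Cmult_neq_0.
  - rewrite discreteF1_psum_add by auto. unfold psum. rewrite <- Sum2_scal.
    apply Sum2_ext. intros m n. unfold coef.
    transitivity (poch a r * gamma_ratio (a + INR r) c (m + n) *
      (weight b1 t1 k1 m * weight b2 t2 k2 n * y ^ n * x ^ (m + n))); [ring|].
    rewrite <- gamma_ratio_shift_num. ring.
  - intros Ha H. apply discreteF1_wild; auto.
    + intros H'. now apply Ha, terminating_shift with r.
    + destruct H as [H|H]; auto. left; split; auto. now apply log_branch_neq_0 with L.
Qed.

(** Divergence is decided by parameters other than [c], so a divergent series stays divergent when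
    [c] becomes [c - r]. *)
Lemma discreteF1_derive_c a b1 b2 c t1 t2 k1 k2 r x y L :
  nonpole c -> nonpole (c - INR r) ->
  (Cmod x < 1)%R -> (Cmod (x * y) < 1)%R -> is_log_branch L x ->
  is_C_derive_n
    (fun z => cpow L (c - 1) z * discreteF1 a b1 b2 c t1 t2 k1 k2 z (z * y))
    r x
    ((-(1)) ^ r * poch (1 - c) r * cpow L (c - INR r - 1) x
      * discreteF1 a b1 b2 (c - INR r) t1 t2 k1 k2 x (x * y)).
Proof.
  intros Hc Hcr Hx Hxy HL.
  rewrite (Cmult_comm ((-(1)) ^ r * poch (1 - c) r)), <- Cmult_assoc.
  replace (c - INR r - 1) with (c - 1 - INR r) by ring.
  destruct (common_radius x y Hx Hxy) as [R0 [H0 [H1 H2]]].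
  apply (cpow_discreteF1_C_derive_n a b1 b2 c t1 t2 k1 k2 Nat.add (fun z => z * y) y)
    with (R0 := R0); auto.
  - intros z. now apply discreteF1_psum_add.
  - intros H. now apply good_coef_add.
  - intros z Hy Hz. now apply Cmult_neq_0.
  - rewrite discreteF1_psum_add by auto. unfold psum. rewrite <- Sum2_scal.
    apply Sum2_ext. intros m n. unfold coef.
    transitivity ((-(1)) ^ r * poch (1 - c) r * gamma_ratio a (c - INR r) (m + n) *
      (weight b1 t1 k1 m * weight b2 t2 k2 n * y ^ n * x ^ (m + n))); [ring|].
    rewrite <- gamma_ratio_shift_den by auto. ring.
  - intros Ha H. apply discreteF1_wild; auto.
    destruct H as [H|H]; auto. left; split; auto. now apply log_branch_neq_0 with L.
Qed.

Theorem mainTheorem6 (a b1 b2 c t1 t2 : C) (k1 k2 r : nat)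
    (hc : forall j : nat, Re c <> (- INR j)%R) :
  (forall (x y : C) (L : C -> C),
    Cmod x < 1 -> Cmod y < 1 -> is_log_branch L x ->
    is_C_derive_n
      (fun z => cpow L (b1 + INR r - 1) z
                * discreteF1 a b1 b2 c t1 t2 k1 k2 z y)
      r x
      (cpow L (b1 - 1) x * poch b1 r
       * discreteF1 a (b1 + INR r) b2 c t1 t2 k1 k2 x y))
  /\
  (forall (x y : C) (L : C -> C),
    Cmod x < 1 -> Cmod y < 1 -> is_log_branch L y ->
    is_C_derive_n
      (fun z => cpow L (b2 + INR r - 1) z
                * discreteF1 a b1 b2 c t1 t2 k1 k2 x z)
      r y
      (cpow L (b2 - 1) y * poch b2 r
       * discreteF1 a b1 (b2 + INR r) c t1 t2 k1 k2 x y))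
  /\
  (forall (x y : C) (L : C -> C),
    Cmod x < 1 -> Cmod (x * y) < 1 -> is_log_branch L x ->
    is_C_derive_n
      (fun z => cpow L (a + INR r - 1) z
                * discreteF1 a b1 b2 c t1 t2 k1 k2 z (z * y))
      r x
      (cpow L (a - 1) x * poch a r
       * discreteF1 (a + INR r) b1 b2 c t1 t2 k1 k2 x (x * y)))
  /\
  (forall (x y : C) (L : C -> C),
    Cmod (x * y) < 1 -> Cmod y < 1 -> is_log_branch L y ->
    is_C_derive_n
      (fun z => cpow L (a + INR r - 1) z
                * discreteF1 a b1 b2 c t1 t2 k1 k2 (x * z) z)
      r y
      (cpow L (a - 1) y * poch a r
       * discreteF1 (a + INR r) b1 b2 c t1 t2 k1 k2 (x * y) y))
  /\
  ((forall j : nat, Re (c - INR r) <> (- INR j)%R) ->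
   forall (x y : C) (L : C -> C),
    Cmod x < 1 -> Cmod (x * y) < 1 -> is_log_branch L x ->
    is_C_derive_n
      (fun z => cpow L (c - 1) z
                * discreteF1 a b1 b2 c t1 t2 k1 k2 z (z * y))
      r x
      ((-(1)) ^ r * poch (1 - c) r * cpow L (c - INR r - 1) x
       * discreteF1 a b1 b2 (c - INR r) t1 t2 k1 k2 x (x * y)))
  /\
  ((forall j : nat, Re (c - INR r) <> (- INR j)%R) ->
   forall (x y : C) (L : C -> C),
    Cmod (x * y) < 1 -> Cmod y < 1 -> is_log_branch L y ->
    is_C_derive_n
      (fun z => cpow L (c - 1) z
                * discreteF1 a b1 b2 c t1 t2 k1 k2 (x * z) z)
      r y
      ((-(1)) ^ r * poch (1 - c) r * cpow L (c - INR r - 1) y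
       * discreteF1 a b1 b2 (c - INR r) t1 t2 k1 k2 (x * y) y)).
Proof.
  repeat split.
  - intros x y L Hx Hy HL. now apply discreteF1_derive_b1.
  - intros x y L Hx Hy HL. rewrite discreteF1_swap.
    replace (fun z => cpow L (b2 + INR r - 1) z * discreteF1 a b1 b2 c t1 t2 k1 k2 x z)
      with (fun z => cpow L (b2 + INR r - 1) z * discreteF1 a b2 b1 c t2 t1 k2 k1 z x)
      by (extensionality z; now rewrite discreteF1_swap).
    now apply discreteF1_derive_b1.
  - intros x y L Hx Hxy HL. now apply discreteF1_derive_a.
  - intros x y L Hxy Hy HL. rewrite discreteF1_swap.
    replace (fun z => cpow L (a + INR r - 1) z * discreteF1 a b1 b2 c t1 t2 k1 k2 (x * z) z)
      with (fun z => cpow L (a + INR r - 1) z * discreteF1 a b2 b1 c t2 t1 k2 k1 z (z * x))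
      by (extensionality z; now rewrite discreteF1_swap, (Cmult_comm z)).
    rewrite (Cmult_comm x) in *. now apply discreteF1_derive_a.
  - intros Hcr x y L Hx Hxy HL. now apply discreteF1_derive_c.
  - intros Hcr x y L Hxy Hy HL. rewrite discreteF1_swap.
    replace (fun z => cpow L (c - 1) z * discreteF1 a b1 b2 c t1 t2 k1 k2 (x * z) z)
      with (fun z => cpow L (c - 1) z * discreteF1 a b2 b1 c t2 t1 k2 k1 z (z * x))
      by (extensionality z; now rewrite discreteF1_swap, (Cmult_comm z)).
    rewrite (Cmult_comm x) in *. now apply discreteF1_derive_c.
Qed.
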